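(* Consider the differential equation $$x'x'''=xx''-2x''^2+x'^2+x^2 \qquad ( * )$$ for real functions $x=x(t)$, and, for $\tau\in\mathbb{R}$, the initial value problem consisting of $( * )$ with $x(0)=0,\ x'(0)=1,\ x''(0)=\tau$, whose solution is denoted by $x_\tau$. There is a positive constant $T$ such that: (i) any smooth solution of $( * )$ which exists everywhere (i.e. on all of $\mathbb{R}$) can be obtained from $x(t)=\exp t$, from $x(t)=\cosh t$, or from one of the solutions $x_\tau:\mathbb{R}\to\mathbb{R}$ with $\tau\in[0,T]$, by a scaling $x\mapsto\alpha_1x$ ($\alpha_1$ a constant) and/or a linear translation of time $t\mapsto\pm t+\alpha_0$ ($\alpha_0$ a constant); (ii) for every $\tau\in[0,T]$ there are smooth functions $\xi_\tau,\zeta_\tau,\mu_\tau,\nu_\tau:[0,+\infty)\to\mathbb{R}$ such that for all $t\in\mathbb{R}$ $$x_\tau'(t)=e^{-t}\,\xi_\tau(e^{2t})=e^{t}\,\zeta_\tau(e^{-2t}),$$ $$\bigl((x_\tau''-x_\tau)\,x_\tau'^2\bigr)(t)=e^{t}\,\mu_\tau(e^{2t})=e^{-t}\,\nu_\tau(e^{-2t});$$ (iii) for $\tau\in[0,T]$, $x_\tau'$ is positive everywhere on $\mathbb{R}$ if and only if $\tau\in[0,T)$, and there is exactly one value $t=t_0$ such that $x_T'(t_0)=0$.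
   Context: All functions are real-valued; $'$ denotes $d/dt$; smooth means $C^\infty$. It is part of the assertion that for $\tau\in[0,T]$ the initial value problem has a smooth solution $x_\tau$ on the whole line $\mathbb{R}$. *)

(* Defs.v *)
From Stdlib Require Import Reals.
From Coquelicot Require Import Coquelicot.
Open Scope R_scope.

Definition smooth (f : R -> R) : Prop :=
  forall (n : nat) (t : R), ex_derive_n f n t.

(* Smoothness of f : [0,+oo) -> R, where f is represented by a total function
   whose values at negative arguments are irrelevant.  The sequence g lists the
   successive derivatives; [D_in] is differentiation relative to the half-line,
   hence one-sided at 0. *)
Definition halfline (u : R) : Prop := 0 <= u.

Definition smooth_halfline (f : R -> R) : Prop :=
  exists g : nat -> R -> R,
    (forall u : R, halfline u -> g 0%nat u = f u) /\
    (forall (n : nat) (u : R),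
       halfline u -> D_in (g n) (g (S n)) halfline u).

Definition global_solution (x : R -> R) : Prop :=
  smooth x /\
  forall t : R,
    Derive x t * Derive_n x 3 t =
    x t * Derive_n x 2 t - 2 * (Derive_n x 2 t) ^ 2 + (Derive x t) ^ 2
    + (x t) ^ 2.

Definition ivp_solution (tau : R) (x : R -> R) : Prop :=
  global_solution x /\
  x 0 = 0 /\ Derive x 0 = 1 /\ Derive_n x 2 0 = tau.

Definition obtained_from (f y : R -> R) : Prop :=
  exists a1 a0 s : R,
    (s = 1 \/ s = -1) /\ forall t : R, y t = a1 * f (s * t + a0).

(* Main.v *)
Require Import Defs.
From Stdlib Require Import Reals Lra Psatz ClassicalEpsilon Ranalysis5.
From Coquelicot Require Import Coquelicot.
Open Scope R_scope.

(** Put E = x'^2 - x^2, Q = (x'' - x) x'^2 and R = Q x'.  Along a solution E' = 2 x' (x'' - x),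
    Q' = - x x' (x'' - x), R' = ((x'' - x) x')^2; hence K = E^2 - 4 x Q and
    4 Q^2 + E^3 / 3 - K E are constant and R is nondecreasing.

    For the data x(0) = 0, x'(0) = 1, x''(0) = tau this reads K = 1 and 4 Q^2 = F(E) with
    F(E) = - E^3 / 3 + E + 4 tau^2 - 2 / 3, and 16 R^2 = G(E) with G = 4 E F + F'^2, G' = 4 F, so
    that E' = 2 F(E) / sqrt(G(E)), x = (E^2 - 1) / (2 sqrt F), x' = sqrt G / (2 sqrt F).
    Let T = 1 / sqrt 3.  If 0 < tau < T, then E runs between two simple zeros of F; there
    G = F'^2, so both rates are 2 in absolute value and E is a smooth function of exp(2t),
    resp. exp(-2t), beyond the end points.  If tau = T, the lower zero -1 is double and is
    reached in finite time; in the coordinate s with s^2 = E + 1 and s of the sign of x' the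
    flow is again regular between two simple zeros, and x' vanishes where s = 0.  If tau > T,
    then R' is bounded below for t <= 0 and R would become negative, whereas Q has no zero.

    In the classification, R = 0 identically forces x'' = x.  Otherwise the symmetries give
    R > 0 and x' > 0 at some point; then x is negative somewhere (else Q could not tend to 0
    backwards in time) and vanishes later (E' >= 2 q (2 - x') with q > 0 a lower bound of Q),
    which leads to the initial value problem with tau > 0. *)

(** * Smooth functions on a set *)

(** The derivative is an existential witness rather than [Derive f], so closure properties are plain
    inductions on the order with an explicit formula for the derivative. Differentiability is
    two-sided at every point of [U]. *)
Fixpoint Cn (n : nat) (U : R -> Prop) (f : R -> R) : Prop :=
  match n with
  | O => True
  | S n => exists g, (forall x, U x -> is_derive f x (g x)) /\ Cn n U g
  end.

Definition Cinf (U : R -> Prop) (f : R -> R) : Prop := forall n, Cn n U f.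

Lemma Cn_pred n U f : Cn (S n) U f -> Cn n U f.
Proof.
  revert f; induction n as [|n IH]; intros f; [easy|].
  intros [g [Hg Hn]]; exists g; split; auto.
Qed.

Lemma Cn_ext n U f g : (forall x, f x = g x) -> Cn n U f -> Cn n U g.
Proof.
  intros Hfg; destruct n as [|n]; [easy|].
  intros [h [Hh Hn]]; exists h; split; [|exact Hn].
  intros x Hx; apply (is_derive_ext f); auto.
Qed.

Lemma Cn_subset n (U V : R -> Prop) f : (forall x, U x -> V x) -> Cn n V f -> Cn n U f.
Proof.
  intros HUV; revert f; induction n as [|n IH]; intros f; [easy|].
  intros [g [Hg Hn]]; exists g; split; auto.
Qed.

Lemma Cn_const n U c : Cn n U (fun _ => c).
Proof.
  revert c; induction n as [|n IH]; intros c; [easy|].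
  exists (fun _ => 0); split; [|apply IH].
  intros x _; apply (@is_derive_const R_AbsRing R_NormedModule).
Qed.

Lemma Cn_id n U : Cn n U (fun x => x).
Proof.
  destruct n as [|n]; [easy|].
  exists (fun _ => 1); split; [|apply Cn_const].
  intros x _; apply (@is_derive_id R_AbsRing).
Qed.

Lemma Cn_plus n U f g : Cn n U f -> Cn n U g -> Cn n U (fun x => f x + g x).
Proof.
  revert f g; induction n as [|n IH]; intros f g; [easy|].
  intros [f' [Hf Hf']] [g' [Hg Hg']].
  exists (fun x => f' x + g' x); split; [|now apply IH].
  intros x Hx; apply (@is_derive_plus R_AbsRing R_NormedModule); auto.
Qed.

Lemma Cn_mult n U f g : Cn n U f -> Cn n U g -> Cn n U (fun x => f x * g x).
Proof.
  revert f g; induction n as [|n IH]; intros f g; [easy|].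
  intros Hf0 Hg0.
  (* The product rule involves [f] and [g] themselves at order [n], not only their derivatives. *)
  pose proof (Cn_pred _ _ _ Hf0) as Hf1; pose proof (Cn_pred _ _ _ Hg0) as Hg1.
  destruct Hf0 as [f' [Hf Hf']]; destruct Hg0 as [g' [Hg Hg']].
  exists (fun x => f' x * g x + f x * g' x); split.
  - intros x Hx; apply (is_derive_mult f g x); auto; intros; apply Rmult_comm.
  - apply Cn_plus; apply IH; assumption.
Qed.

Lemma Cn_opp n U f : Cn n U f -> Cn n U (fun x => - f x).
Proof.
  intros Hf; apply Cn_ext with (fun x => -1 * f x); [intros; ring|].
  apply Cn_mult; [apply Cn_const|exact Hf].
Qed.

Lemma Cn_minus n U f g : Cn n U f -> Cn n U g -> Cn n U (fun x => f x - g x).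
Proof. intros; apply Cn_plus; [|apply Cn_opp]; assumption. Qed.

Lemma Cn_pow n U f k : Cn n U f -> Cn n U (fun x => f x ^ k).
Proof.
  intros Hf; induction k as [|k IH]; [exact (Cn_const n U 1)|].
  simpl; apply Cn_mult; assumption.
Qed.

Lemma Cn_comp n (U V : R -> Prop) f g :
  (forall x, U x -> V (g x)) -> Cn n V f -> Cn n U g -> Cn n U (fun x => f (g x)).
Proof.
  intros HUV; revert f; induction n as [|n IH]; intros f; [easy|].
  intros [f' [Hf Hf']] Hg0.
  pose proof (Cn_pred _ _ _ Hg0) as Hg1.
  destruct Hg0 as [g' [Hg Hg']].
  exists (fun x => g' x * f' (g x)); split.
  - intros x Hx; apply (is_derive_comp f g x); auto.
  - apply Cn_mult; auto.
Qed.

(* Smoothness of a function from a differential equation it satisfies: each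
   order of differentiability of [f] passes to [g], hence to one order more of [f]. *)
Lemma Cn_bootstrap U f g :
  (forall x, U x -> is_derive f x (g x)) ->
  (forall n, Cn n U f -> Cn n U g) -> Cinf U f.
Proof.
  intros Hfg Hn n; induction n as [|n IH]; [easy|].
  exists g; auto.
Qed.

Lemma Cn_exp n U : Cn n U exp.
Proof.
  apply (Cn_bootstrap U exp exp); [intros; apply is_derive_exp|auto].
Qed.

(** The reciprocal satisfies [r' = - r^2] away from [0], so it is smooth there by bootstrapping;
    composition does the rest. [Cn_sqrt] uses [r' = 1 / (2 r)] in the same way. *)
Lemma Cn_inv n U f : (forall x, U x -> f x <> 0) -> Cn n U f -> Cn n U (fun x => / f x).
Proof.
  intros H0; apply (Cn_comp n U (fun x => x <> 0) Rinv f); [exact H0|].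
  apply (Cn_bootstrap _ Rinv (fun x => - (/ x * / x))).
  - intros x Hx; auto_derive; [exact Hx|field; exact Hx].
  - intros m H; apply Cn_opp, Cn_mult; exact H.
Qed.

Lemma Cn_div n U f g :
  (forall x, U x -> g x <> 0) -> Cn n U f -> Cn n U g -> Cn n U (fun x => f x / g x).
Proof. intros; apply Cn_mult; [|apply Cn_inv]; assumption. Qed.

Lemma Cn_sqrt n U f : (forall x, U x -> 0 < f x) -> Cn n U f -> Cn n U (fun x => sqrt (f x)).
Proof.
  intros H0; apply (Cn_comp n U (fun x => 0 < x) sqrt f); [exact H0|].
  apply (Cn_bootstrap _ sqrt (fun x => / (2 * sqrt x))).
  - intros x Hx; auto_derive; [exact Hx|field].
    apply Rgt_not_eq, sqrt_lt_R0, Hx.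
  - intros m H; apply Cn_inv.
    + intros x Hx; pose proof (sqrt_lt_R0 x Hx); lra.
    + apply Cn_mult; [apply Cn_const|exact H].
Qed.

(** Passage from witnesses to the total operator [Derive_n]: since [U] is open, agreement on [U] is
    agreement near each of its points, which is all that [Derive] sees. *)
Lemma Cn_Derive_n m n U f :
  open U -> Cn (n + m) U f ->
  exists g, Cn m U g /\ forall x, U x -> Derive_n f n x = g x.
Proof.
  intros HU; revert m; induction n as [|n IH]; intros m Hf; [now exists f|].
  destruct (IH (S m)) as [g [[h [Hgh Hh]] Hg]]; [now rewrite Nat.add_succ_r|].
  exists h; split; [exact Hh|]; intros x Hx; simpl.
  rewrite (Derive_ext_loc _ g); [now apply is_derive_unique, Hgh|].
  destruct (HU x Hx) as [eps Heps]; exists eps; auto.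
Qed.

Lemma Cinf_is_derive_n U f n x :
  open U -> Cinf U f -> U x -> is_derive (Derive_n f n) x (Derive_n f (S n) x).
Proof.
  intros HU Hf Hx; apply Derive_correct.
  destruct (Cn_Derive_n 1 n U f HU (Hf _)) as [g [[h [Hgh _]] Hg]].
  apply ex_derive_ext_loc with g; [|exists (h x); auto].
  destruct (HU x Hx) as [eps Heps]; exists eps; intros; symmetry; auto.
Qed.

Lemma Cinf_smooth f : Cinf (fun _ => True) f -> smooth f.
Proof.
  intros Hf [|n] t; [exact I|].
  exists (Derive_n f (S n) t); now apply (Cinf_is_derive_n (fun _ => True)), I; [apply open_true|].
Qed.

Lemma is_derive_D_in f g (D : R -> Prop) x : is_derive f x (g x) -> D_in f g D x.
Proof.
  intros H; apply is_derive_Reals, derivable_pt_lim_D_in in H.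
  intros eps Heps; destruct (H eps Heps) as [d [Hd Hlim]].
  exists d; split; [exact Hd|]; intros z [[_ Hz] Hdist].
  apply Hlim; repeat split; assumption.
Qed.

(** Smoothness slightly beyond [0] makes the one-sided derivatives at [0] restrictions of ordinary
    ones, so [Derive_n f] serves as the sequence of derivatives. *)
Lemma Cinf_smooth_halfline d f : 0 < d -> Cinf (fun u => - d < u) f -> smooth_halfline f.
Proof.
  intros Hd Hf; exists (Derive_n f); split; [easy|]; unfold halfline; intros n u Hu.
  apply is_derive_D_in, (Cinf_is_derive_n (fun u => - d < u)); [apply open_gt|exact Hf|lra].
Qed.

Lemma smooth_is_derive f n t : smooth f -> is_derive (Derive_n f n) t (Derive_n f (S n) t).
Proof. intros Hf; apply Derive_correct, (Hf (S n)). Qed.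

Ltac Cn_auto :=
  repeat first
    [ assumption | apply Cn_const | apply Cn_id | apply Cn_plus | apply Cn_minus | apply Cn_opp
    | apply Cn_mult | apply Cn_pow | apply Cn_exp ].

(** * Monotonicity, signs and zeros of differentiable functions *)

Lemma is_derive_continuity f x l : is_derive f x l -> continuity_pt f x.
Proof.
  intros H; apply derivable_continuous_pt; exists l; now apply is_derive_Reals.
Qed.

Lemma nondecreasing_of_derive f f' a b :
  a <= b -> (forall t, a <= t <= b -> is_derive f t (f' t)) ->
  (forall t, a < t < b -> 0 <= f' t) -> f a <= f b.
Proof.
  intros Hab Hf Hpos; destruct (Req_dec a b) as [->|Hne]; [lra|].
  destruct (MVT_cor2 f f' a b) as [c [Heq Hc]]; [lra| |].
  - intros; now apply is_derive_Reals, Hf.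
  - pose proof (Hpos c Hc); nra.
Qed.

Lemma constant_on (f : R -> R) a b : (forall s, a < s < b -> is_derive f s 0) ->
  forall s t, a < s < b -> a < t < b -> f s = f t.
Proof.
  intros Hf.
  assert (Hle : forall s t, a < s -> s <= t -> t < b -> f s = f t).
  { intros s t Hs Hst Ht; apply Rle_antisym.
    - apply (nondecreasing_of_derive f (fun _ => 0)); intros; [lra|apply Hf; lra|lra].
    - assert (- f s <= - f t); [|lra].
      apply (nondecreasing_of_derive (fun u => - f u) (fun _ => - 0)); intros; [lra| |lra].
      apply (@is_derive_opp R_AbsRing R_NormedModule f), Hf; lra. }
  intros s t Hs Ht; destruct (Rle_dec s t); [|symmetry]; apply Hle; lra.
Qed.

Lemma constant_of_derive f : (forall t, is_derive f t 0) -> forall s t, f s = f t.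
Proof.
  intros Hf s t; apply (constant_on f (Rmin s t - 1) (Rmax s t + 1)); [auto| |];
    pose proof (Rmin_l s t); pose proof (Rmin_r s t);
    pose proof (Rmax_l s t); pose proof (Rmax_r s t); lra.
Qed.

Lemma continuity_pos_near f x :
  continuity_pt f x -> 0 < f x ->
  exists d, 0 < d /\ forall y, Rabs (y - x) < d -> 0 < f y.
Proof.
  intros Hf Hpos; destruct (Hf (f x) Hpos) as [d [Hd H]].
  exists d; split; [exact Hd|]; intros y Hy.
  destruct (Req_dec y x) as [->|Hne]; [exact Hpos|].
  assert (Hdist : Rabs (f y - f x) < f x).
  { apply (H y); repeat split; auto. }
  apply Rabs_def2 in Hdist; lra.
Qed.

(** [c] is the supremum of the points of [[a, b]] where [f <= 0]. The lemma serves to continue a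
    sign condition backwards from [b] until it first fails. *)
Lemma last_zero f a b :
  a <= b -> (forall t, a <= t <= b -> continuity_pt f t) -> f a <= 0 -> 0 < f b ->
  exists c, a <= c < b /\ f c = 0 /\ forall t, c < t <= b -> 0 < f t.
Proof.
  intros Hab Hf Ha Hb.
  set (N := fun t => a <= t <= b /\ f t <= 0).
  destruct (completeness N) as [c [Hub Hlub]].
  - exists b; intros t [Ht _]; lra.
  - exists a; split; [lra|exact Ha].
  - assert (Hac : a <= c) by (apply Hub; split; [lra|exact Ha]).
    assert (Hcb : c <= b) by (apply Hlub; intros t [Ht _]; lra).
    assert (Hright : forall t, c < t <= b -> 0 < f t).
    { intros t Ht; destruct (Rlt_le_dec 0 (f t)) as [|Hle]; [assumption|].
      assert (t <= c) by (apply Hub; split; lra); lra. }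
    assert (Hc0 : f c <= 0).
    { destruct (Rlt_le_dec 0 (f c)) as [Hpos|]; [exfalso|assumption].
      destruct (continuity_pos_near f c) as [d [Hd Hnear]]; auto.
      assert (c <= c - d); [|lra].
      apply Hlub; intros t Ht; pose proof (Hub t Ht).
      destruct (Rle_lt_dec t (c - d)) as [|Hlt]; [assumption|].
      assert (0 < f t) by (apply Hnear, Rabs_def1; lra).
      destruct Ht; lra. }
    assert (c <> b) by (intros ->; lra).
    exists c; split; [lra|]; split; [|exact Hright].
    (* A negative value at [c] would persist a little to the right of [c], where [f] is already
       known to be positive. *)
    destruct (Rle_lt_or_eq_dec _ _ Hc0) as [Hneg|]; [exfalso|assumption].
    destruct (continuity_pos_near (fun t => - f t) c) as [d [Hd Hnear]].
    + apply continuity_pt_opp, Hf; lra.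
    + lra.
    + set (t := c + Rmin d (b - c) / 2).
      assert (0 < Rmin d (b - c)) by (apply Rmin_pos; lra).
      pose proof (Rmin_l d (b - c)); pose proof (Rmin_r d (b - c)).
      assert (0 < - f t) by (apply Hnear, Rabs_def1; unfold t; lra).
      assert (0 < f t) by (apply Hright; unfold t; lra); lra.
Qed.

Lemma pos_of_nonzero f a b :
  a <= b -> (forall t, a <= t <= b -> continuity_pt f t) ->
  (forall t, a <= t <= b -> f t <> 0) -> 0 < f b -> 0 < f a.
Proof.
  intros Hab Hf Hne Hb; destruct (Rlt_le_dec 0 (f a)) as [|Ha]; [assumption|exfalso].
  destruct (last_zero f a b) as [c [Hc [H0 _]]]; auto.
  apply (Hne c); [lra|exact H0].
Qed.

Lemma pos_everywhere f s :
  (forall t, continuity_pt f t) -> (forall t, f t <> 0) -> 0 < f s -> forall t, 0 < f t.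
Proof.
  intros Hf Hne Hs t; destruct (Rle_dec t s).
  - apply (pos_of_nonzero f t s); auto.
  - rewrite <- (Ropp_involutive t).
    apply (pos_of_nonzero (fun u => f (- u)) (- t) (- s)); auto; [lra| |now rewrite Ropp_involutive].
    intros u _; apply (continuity_pt_comp Ropp f); [|apply Hf].
    apply continuity_pt_opp, continuity_pt_id.
Qed.

(** * First integrals *)

(** The derivatives are carried as separate functions, so that closed formulas and rescaled
    solutions can be inserted directly, without computing [Derive_n]. *)
Record sol (y y1 y2 y3 : R -> R) : Prop := Sol {
  sol_d1 : forall t, is_derive y t (y1 t);
  sol_d2 : forall t, is_derive y1 t (y2 t);
  sol_d3 : forall t, is_derive y2 t (y3 t);
  sol_eq : forall t, y1 t * y3 t = y t * y2 t - 2 * (y2 t) ^ 2 + (y1 t) ^ 2 + (y t) ^ 2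
}.

Lemma global_solution_sol y :
  global_solution y -> sol y (Derive y) (Derive_n y 2) (Derive_n y 3).
Proof.
  intros [Hs Heq]; split; [| | |exact Heq]; intros t.
  - exact (smooth_is_derive y 0 t Hs).
  - exact (smooth_is_derive y 1 t Hs).
  - exact (smooth_is_derive y 2 t Hs).
Qed.

Lemma sol_derivatives y y1 y2 y3 : sol y y1 y2 y3 ->
  forall t, Derive y t = y1 t /\ Derive_n y 2 t = y2 t /\ Derive_n y 3 t = y3 t.
Proof.
  intros [H1 H2 H3 _].
  assert (E1 : forall t, Derive y t = y1 t) by (intros; apply is_derive_unique; auto).
  assert (E2 : forall t, Derive_n y 2 t = y2 t).
  { intros t; simpl; rewrite (Derive_ext _ y1) by exact E1; apply is_derive_unique; auto. }
  intros t; repeat split; auto.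
  change (Derive (Derive_n y 2) t = y3 t).
  rewrite (Derive_ext _ y2) by exact E2; apply is_derive_unique; auto.
Qed.

Lemma sol_global_solution y y1 y2 y3 : smooth y -> sol y y1 y2 y3 -> global_solution y.
Proof.
  intros Hs H; split; [exact Hs|]; intros t.
  destruct (sol_derivatives _ _ _ _ H t) as [-> [-> ->]]; apply H.
Qed.

Lemma is_derive_affine (y : R -> R) t s a l :
  is_derive y (s * t + a) l -> is_derive (fun t => y (s * t + a)) t (s * l).
Proof.
  intros H; apply (is_derive_comp y (fun t => s * t + a) t l s H).
  auto_derive; [easy|ring].
Qed.

(** The equation is homogeneous of degree two, autonomous, and each of its monomials contains an
    even number of differentiations; hence it survives scaling, translation and reversal of time. *)
Lemma sol_affine y y1 y2 y3 c s a : s = 1 \/ s = -1 -> sol y y1 y2 y3 ->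
  sol (fun t => c * y (s * t + a)) (fun t => c * s * y1 (s * t + a))
      (fun t => c * y2 (s * t + a)) (fun t => c * s * y3 (s * t + a)).
Proof.
  intros Hs [H1 H2 H3 Heq].
  assert (Hss : s * s = 1) by (destruct Hs; subst; ring).
  split; intros t.
  - evar_last; [apply is_derive_scal, is_derive_affine, H1|ring].
  - evar_last; [apply is_derive_scal, is_derive_affine, H2|].
    replace (c * y2 (s * t + a)) with (c * (s * s) * y2 (s * t + a)) by (rewrite Hss; ring); ring.
  - evar_last; [apply is_derive_scal, is_derive_affine, H3|ring].
  - specialize (Heq (s * t + a)).
    transitivity (c ^ 2 * (s * s) * (y1 (s * t + a) * y3 (s * t + a))); [ring|].
    rewrite Heq; transitivity (c ^ 2 * (y (s * t + a) * y2 (s * t + a) - 2 * y2 (s * t + a) ^ 2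
      + (s * s) * y1 (s * t + a) ^ 2 + y (s * t + a) ^ 2)); [rewrite Hss|]; ring.
Qed.

(* The letters [E], [Q], [R] of the header. *)
Definition En (y y1 : R -> R) t := y1 t ^ 2 - y t ^ 2.
Definition Qn (y y1 y2 : R -> R) t := (y2 t - y t) * y1 t ^ 2.
Definition Rn (y y1 y2 : R -> R) t := (y2 t - y t) * y1 t ^ 3.

(* [auto_derive] leaves eta-expanded [Derive (fun x => f x) t]. *)
Ltac rewrite_derive H :=
  match type of H with is_derive ?f ?t ?l =>
    repeat change (Derive (fun x => f x) t) with (Derive f t);
    rewrite ?(is_derive_unique f t l H) end.

Lemma is_derive_En y y1 y2 y3 t : sol y y1 y2 y3 ->
  is_derive (En y y1) t (2 * y1 t * (y2 t - y t)).
Proof.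
  intros [H1 H2 _ _]; unfold En; auto_derive.
  - repeat split; eexists; auto.
  - specialize (H1 t); rewrite_derive H1; specialize (H2 t); rewrite_derive H2; ring.
Qed.

Lemma is_derive_Qn y y1 y2 y3 t : sol y y1 y2 y3 ->
  is_derive (Qn y y1 y2) t (- y t * y1 t * (y2 t - y t)).
Proof.
  intros [H1 H2 H3 Heq]; unfold Qn; auto_derive.
  - repeat split; eexists; auto.
  - specialize (H1 t); rewrite_derive H1; specialize (H2 t); rewrite_derive H2; specialize (H3 t); rewrite_derive H3.
    (* The third derivative enters only through [y1 * y3], multiplied by [y1], so the equation is
       inserted without dividing by [y1], which may vanish. *)
    specialize (Heq t); apply (f_equal (Rmult (y1 t))) in Heq; lra.
Qed.

Lemma is_derive_Rn y y1 y2 y3 t : sol y y1 y2 y3 ->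
  is_derive (Rn y y1 y2) t (((y2 t - y t) * y1 t) ^ 2).
Proof.
  intros [H1 H2 H3 Heq]; unfold Rn; auto_derive.
  - repeat split; eexists; auto.
  - specialize (H1 t); rewrite_derive H1; specialize (H2 t); rewrite_derive H2; specialize (H3 t); rewrite_derive H3.
    specialize (Heq t); apply (f_equal (Rmult (y1 t ^ 2))) in Heq; lra.
Qed.

Lemma Rn_nondecreasing y y1 y2 y3 s t : sol y y1 y2 y3 -> s <= t ->
  Rn y y1 y2 s <= Rn y y1 y2 t.
Proof.
  intros H Hst; eapply nondecreasing_of_derive; [exact Hst| |].
  - intros; eapply is_derive_Rn, H.
  - intros; apply pow2_ge_0.
Qed.

Lemma first_integral y y1 y2 y3 s t : sol y y1 y2 y3 ->
  En y y1 s ^ 2 - 4 * y s * Qn y y1 y2 s = En y y1 t ^ 2 - 4 * y t * Qn y y1 y2 t.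
Proof.
  intros H.
  apply (constant_of_derive (fun t => En y y1 t ^ 2 - 4 * y t * Qn y y1 y2 t)); clear s t; intros t.
  pose proof (is_derive_En _ _ _ _ t H) as HE; pose proof (is_derive_Qn _ _ _ _ t H) as HQ.
  pose proof (sol_d1 _ _ _ _ H t) as H1.
  auto_derive; [repeat split; eexists; eauto|].
  rewrite_derive H1; rewrite_derive HE; rewrite_derive HQ.
  unfold En, Qn; ring.
Qed.

(** Inserting [K = E^2 - 4 y Q] turns the derivative of the left side into [8 Q Q' + 4 y Q E'],
    which vanishes because [2 Q' = - y E']. *)
Lemma second_integral y y1 y2 y3 K s t : sol y y1 y2 y3 ->
  (forall t, En y y1 t ^ 2 - 4 * y t * Qn y y1 y2 t = K) ->
  4 * Qn y y1 y2 s ^ 2 + En y y1 s ^ 3 / 3 - K * En y y1 s =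
  4 * Qn y y1 y2 t ^ 2 + En y y1 t ^ 3 / 3 - K * En y y1 t.
Proof.
  intros H HK.
  apply (constant_of_derive (fun t => 4 * Qn y y1 y2 t ^ 2 + En y y1 t ^ 3 / 3 - K * En y y1 t)).
  clear s t; intros t; specialize (HK t).
  pose proof (is_derive_En _ _ _ _ t H) as HE; pose proof (is_derive_Qn _ _ _ _ t H) as HQ.
  auto_derive; [repeat split; eexists; eauto|].
  rewrite_derive HE; rewrite_derive HQ; rewrite <- HK.
  unfold En, Qn; field.
Qed.

Definition ivp tau (y y1 y2 y3 : R -> R) :=
  sol y y1 y2 y3 /\ y 0 = 0 /\ y1 0 = 1 /\ y2 0 = tau.

(** The [F] of the header, with [F' = 1 - E^2]. *)
Definition cubic tau E := - E ^ 3 / 3 + E + 4 * tau ^ 2 - 2 / 3.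

Lemma ivp_integrals tau y y1 y2 y3 t : ivp tau y y1 y2 y3 ->
  4 * y t * Qn y y1 y2 t = En y y1 t ^ 2 - 1 /\ 4 * Qn y y1 y2 t ^ 2 = cubic tau (En y y1 t).
Proof.
  intros [H [Hy [Hy1 Hy2]]].
  assert (HK : forall t, En y y1 t ^ 2 - 4 * y t * Qn y y1 y2 t = 1).
  { intros s; rewrite (first_integral _ _ _ _ s 0 H); unfold En; rewrite Hy, Hy1; ring. }
  split; [specialize (HK t); lra|].
  pose proof (second_integral _ _ _ _ 1 t 0 H HK) as HL.
  unfold En at 3 4, Qn at 2 in HL; rewrite Hy, Hy1, Hy2 in HL; unfold cubic; lra.
Qed.

(* If [Qn] vanishes, so do [cubic tau] and its derivative [1 - E^2] at the energy [E = En y y1 t]. *)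
Lemma ivp_Qn_zero tau y y1 y2 y3 t : ivp tau y y1 y2 y3 -> Qn y y1 y2 t = 0 -> 0 < tau ->
  En y y1 t = -1 /\ 3 * tau ^ 2 = 1.
Proof.
  intros H HQ Htau; destruct (ivp_integrals _ _ _ _ _ t H) as [H1 H2].
  rewrite HQ in H1, H2; unfold cubic in H2.
  assert (Hor : (En y y1 t - 1) * (En y y1 t + 1) = 0) by lra.
  apply Rmult_integral in Hor; destruct Hor as [Hor|Hor].
  - replace (En y y1 t) with 1 in H2 by lra; nra.
  - replace (En y y1 t) with (-1) in * by lra; split; lra.
Qed.

(** * Signs along a solution *)

Lemma sol_continuity y y1 y2 y3 t : sol y y1 y2 y3 ->
  continuity_pt y t /\ continuity_pt y1 t /\ continuity_pt y2 t /\ continuity_pt (En y y1) t /\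
  continuity_pt (Qn y y1 y2) t /\ continuity_pt (Rn y y1 y2) t.
Proof.
  intros H; repeat split; eapply is_derive_continuity.
  - apply (sol_d1 _ _ _ _ H).
  - apply (sol_d2 _ _ _ _ H).
  - apply (sol_d3 _ _ _ _ H).
  - eapply is_derive_En, H.
  - eapply is_derive_Qn, H.
  - eapply is_derive_Rn, H.
Qed.

Lemma Rn_Qn y y1 y2 t : Rn y y1 y2 t = Qn y y1 y2 t * y1 t.
Proof. unfold Rn, Qn; ring. Qed.

Lemma Rn_pos_signs y y1 y2 t : 0 < Rn y y1 y2 t -> 0 < y1 t ->
  0 < y2 t - y t /\ 0 < Qn y y1 y2 t.
Proof.
  unfold Rn, Qn; intros HR H1.
  assert (HD : 0 < y2 t - y t).
  { destruct (Rlt_le_dec 0 (y2 t - y t)) as [|HD]; [assumption|].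
    pose proof (pow_lt _ 3 H1); nra. }
  split; [exact HD|]; apply Rmult_lt_0_compat; [exact HD|now apply pow_lt].
Qed.

Lemma Rn_pos_deriv_nonzero y y1 y2 t : 0 < Rn y y1 y2 t -> y1 t <> 0.
Proof. unfold Rn; intros HR H1; rewrite H1 in HR; lra. Qed.

(** Monotonicity makes [Rn] positive from [s] onwards, and [y1] has no zero where [Rn] is positive.
    The next lemma is the same argument in reversed time. *)
Lemma deriv_pos_left y y1 y2 y3 s t : sol y y1 y2 y3 -> s <= t -> 0 < y1 t ->
  0 < Rn y y1 y2 s -> 0 < y1 s.
Proof.
  intros H Hst Hy1 HR; apply (pos_of_nonzero y1 s t); [exact Hst| | |exact Hy1].
  - intros; apply (sol_continuity _ _ _ _ _ H).
  - intros u Hu; apply (Rn_pos_deriv_nonzero y y1 y2).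
    pose proof (Rn_nondecreasing _ _ _ _ s u H); lra.
Qed.

Lemma deriv_pos_right y y1 y2 y3 s t : sol y y1 y2 y3 -> s <= t -> 0 < y1 s ->
  0 < Rn y y1 y2 s -> 0 < y1 t.
Proof.
  intros H Hst Hy1 HR.
  destruct (Rlt_le_dec 0 (y1 t)) as [|Hle]; [assumption|exfalso].
  destruct (last_zero (fun u => y1 (- u)) (- t) (- s)) as [c [Hc [H0 _]]].
  - lra.
  - intros u _; apply (continuity_pt_comp Ropp y1).
    + apply continuity_pt_opp, continuity_pt_id.
    + apply (sol_continuity _ _ _ _ _ H).
  - now rewrite Ropp_involutive.
  - now rewrite Ropp_involutive.
  - apply (Rn_pos_deriv_nonzero y y1 y2 (- c)); [|exact H0].
    pose proof (Rn_nondecreasing _ _ _ _ s (- c) H); lra.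
Qed.

Lemma growth_of_derive f f' a b c :
  a <= b -> (forall t, a <= t <= b -> is_derive f t (f' t)) ->
  (forall t, a <= t <= b -> c <= f' t) -> c * (b - a) <= f b - f a.
Proof.
  intros Hab Hf Hc.
  assert (f a - c * a <= f b - c * b); [|lra].
  apply (nondecreasing_of_derive (fun t => f t - c * t) (fun t => f' t - c)); [exact Hab| |].
  - intros t Ht; apply (@is_derive_minus R_AbsRing R_NormedModule f (fun t => c * t)); auto.
    auto_derive; [easy|ring].
  - intros t Ht; assert (c <= f' t) by (apply Hc; lra); lra.
Qed.

(** Suppose [y >= 0] as long as [Rn > 0] before [t1]. Backwards in time [Qn] then stays above [q]
    while [y1] stays below [y1 t1], so [y2 - y >= c]; thus [y1] falls at rate at least [c] and would
    become negative after a bounded time. *)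
Lemma exists_negative y y1 y2 y3 t1 : sol y y1 y2 y3 ->
  0 < Rn y y1 y2 t1 -> 0 < y1 t1 ->
  exists t, 0 < Rn y y1 y2 t /\ 0 < y1 t /\ y t < 0.
Proof.
  intros H HR1 Hy1.
  set (q := Qn y y1 y2 t1); set (c := q / (y1 t1) ^ 2).
  destruct (Rn_pos_signs _ _ _ _ HR1 Hy1) as [_ Hq]; fold q in Hq.
  pose proof (pow_lt _ 2 Hy1) as Hy1sq.
  assert (Hc : 0 < c) by now apply Rdiv_lt_0_compat.
  (* Over this length a loss at rate [c] amounts to [y1 t1 + c], more than [y1] has at [t1]. *)
  set (t3 := t1 - (y1 t1 / c + 1)).
  assert (Ht3 : t3 < t1) by (unfold t3; pose proof (Rdiv_lt_0_compat _ _ Hy1 Hc); lra).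
  destruct (classic (exists t, t3 <= t <= t1 /\ 0 < Rn y y1 y2 t /\ y t < 0)) as [[t [Ht [HR Hneg]]]|Hno].
  { exists t; split; [exact HR|]; split; [|exact Hneg].
    apply (deriv_pos_left _ _ _ _ t t1 H); auto; lra. }
  exfalso.
  assert (Hnn : forall t, t3 <= t <= t1 -> 0 < Rn y y1 y2 t -> 0 <= y t).
  { intros t Ht HR; destruct (Rle_lt_dec 0 (y t)); [assumption|exfalso; apply Hno; eauto]. }
  assert (HQ : forall b, t3 <= b <= t1 -> (forall t, b < t <= t1 -> 0 < Rn y y1 y2 t) ->
     q <= Qn y y1 y2 b).
  { intros b Hb HR.
    assert (- Qn y y1 y2 b <= - Qn y y1 y2 t1); [|unfold q; lra].
    apply (nondecreasing_of_derive (fun t => - Qn y y1 y2 t)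
             (fun t => - (- y t * y1 t * (y2 t - y t)))); [lra| |].
    - intros t _; apply (@is_derive_opp R_AbsRing R_NormedModule).
      eapply is_derive_Qn, H.
    - intros t Ht; assert (HRt : 0 < Rn y y1 y2 t) by (apply HR; lra).
      assert (Hyt : 0 < y1 t) by (apply (deriv_pos_left _ _ _ _ t t1 H); auto; lra).
      destruct (Rn_pos_signs _ _ _ _ HRt Hyt) as [HD _].
      assert (0 <= y t) by (apply Hnn; auto; lra).
      assert (0 <= y t * y1 t * (y2 t - y t)) by (repeat apply Rmult_le_pos; lra); lra. }
  destruct (Rle_lt_dec (Rn y y1 y2 t3) 0) as [Hle|Hlt].
  (* [Rn] cannot reach [0] in the window: where it does, [Qn >= q > 0] forces [y1 = 0], and then
     [Qn = 0]. *)
  - destruct (last_zero (Rn y y1 y2) t3 t1) as [b [Hb [H0 Hpos]]]; auto; [lra| |].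
    { intros; apply (sol_continuity _ _ _ _ _ H). }
    assert (HQb : q <= Qn y y1 y2 b) by (apply HQ; [lra|exact Hpos]).
    rewrite Rn_Qn in H0; apply Rmult_integral in H0; destruct H0 as [H0|H0]; [lra|].
    unfold Qn at 1 in HQb; rewrite H0 in HQb; lra.
  - assert (HR : forall t, t3 <= t <= t1 -> 0 < Rn y y1 y2 t).
    { intros t Ht; pose proof (Rn_nondecreasing _ _ _ _ t3 t H); lra. }
    assert (Hp : forall t, t3 <= t <= t1 -> 0 < y1 t).
    { intros t Ht; apply (deriv_pos_left _ _ _ _ t t1 H); auto; lra. }
    assert (Hmono : forall t, t3 <= t <= t1 -> y1 t <= y1 t1).
    { intros t Ht; apply (nondecreasing_of_derive y1 y2); [lra| |].
      - intros; apply (sol_d2 _ _ _ _ H).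
      - intros u Hu; assert (Hu' : t3 <= u <= t1) by lra.
        destruct (Rn_pos_signs _ _ _ _ (HR u Hu') (Hp u Hu')) as [HD _].
        pose proof (Hnn u Hu' (HR u Hu')); lra. }
    assert (Hgrow : c * (t1 - t3) <= y1 t1 - y1 t3).
    { apply (growth_of_derive y1 y2); [lra| |].
      - intros; apply (sol_d2 _ _ _ _ H).
      - intros t Ht; pose proof (Hp t Ht); pose proof (Hmono t Ht); pose proof (Hnn t Ht (HR t Ht)).
        destruct (Rn_pos_signs _ _ _ _ (HR t Ht) (Hp t Ht)) as [HD _].
        assert (HQt : q <= Qn y y1 y2 t) by (apply HQ; [lra|intros; apply HR; lra]).
        assert (c <= y2 t - y t); [|lra].
        apply Rmult_le_reg_r with (y1 t1 ^ 2); [exact Hy1sq|].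
        unfold c, Rdiv; rewrite Rmult_assoc, Rinv_l, Rmult_1_r by lra.
        unfold Qn at 1 in HQt; apply Rle_trans with (1 := HQt).
        apply Rmult_le_compat_l; [lra|]; apply pow_incr; lra. }
    pose proof (Hp t3).
    assert (c * (t1 - t3) = y1 t1 + c) by (unfold t3; field; lra).
    lra.
Qed.

(** If [y] stayed negative after the point given by [exists_negative], [Qn] would be nondecreasing
    and the energy would have a linearly growing lower bound. Since [y1^2] dominates the energy,
    [y1] would end up at least [1], which drives [y] up to [0]. *)
Lemma exists_zero y y1 y2 y3 t1 : sol y y1 y2 y3 ->
  0 < Rn y y1 y2 t1 -> 0 < y1 t1 ->
  exists t, y t = 0 /\ 0 < y1 t /\ 0 < y2 t.
Proof.
  intros H HR1 Hy1.
  destruct (exists_negative _ _ _ _ _ H HR1 Hy1) as [t2 [HR2 [Hy12 Hneg]]].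
  assert (HR : forall t, t2 <= t -> 0 < Rn y y1 y2 t).
  { intros t Ht; pose proof (Rn_nondecreasing _ _ _ _ t2 t H); lra. }
  assert (Hp : forall t, t2 <= t -> 0 < y1 t).
  { intros t Ht; apply (deriv_pos_right _ _ _ _ t2 t H); auto. }
  assert (Hpos : exists t, t2 <= t /\ 0 <= y t).
  { destruct (classic (exists t, t2 <= t /\ 0 <= y t)) as [|Hno]; [assumption|exfalso].
    assert (Hn : forall t, t2 <= t -> y t < 0).
    { intros t Ht; destruct (Rle_lt_dec 0 (y t)); [exfalso; apply Hno; eauto|assumption]. }
    set (q := Qn y y1 y2 t2).
    destruct (Rn_pos_signs _ _ _ _ HR2 Hy12) as [_ Hq]; fold q in Hq.
    assert (HQ : forall t, t2 <= t -> q <= Qn y y1 y2 t).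
    { intros t Ht; eapply nondecreasing_of_derive; [exact Ht| |].
      - intros; eapply is_derive_Qn, H.
      - intros u Hu; assert (Hu' : t2 <= u) by lra.
        destruct (Rn_pos_signs _ _ _ _ (HR u Hu') (Hp u Hu')) as [HD _].
        pose proof (Hn u Hu'); pose proof (Hp u Hu').
        assert (0 <= (- y u) * y1 u * (y2 u - y u)) by (repeat apply Rmult_le_pos; lra); lra. }
    (* [E' = 2 Q / y' >= 2 q (2 - y')] *)
    assert (HE : forall t, t2 <= t ->
      En y y1 t2 + 2 * q * y t2 + 4 * q * (t - t2) <= En y y1 t).
    { intros t Ht.
      assert (Hg : 4 * q * (t - t2) <= (En y y1 t + 2 * q * y t) - (En y y1 t2 + 2 * q * y t2)).
      { apply (growth_of_derive (fun u => En y y1 u + 2 * q * y u)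
                 (fun u => 2 * y1 u * (y2 u - y u) + 2 * q * y1 u)); [exact Ht| |].
        - intros u _; apply (@is_derive_plus R_AbsRing R_NormedModule (En y y1)).
          + eapply is_derive_En, H.
          + apply (is_derive_scal y u (2 * q)), (sol_d1 _ _ _ _ H).
        - intros u [Hu _]; pose proof (HQ u Hu) as HQu; pose proof (Hp u Hu).
          unfold Qn at 1 in HQu.
          apply Rmult_le_reg_r with (y1 u); [assumption|].
          assert (0 <= q * (y1 u - 1) ^ 2) by (apply Rmult_le_pos; [lra|apply pow2_ge_0]).
          nra. }
      pose proof (Hn t Ht).
      assert (q * y t <= 0) by nra; lra. }
    set (B := En y y1 t2 + 2 * q * y t2).
    (* From this time on the lower bound [B + 4 q (t - t2)] of the energy is at least [1]. *)
    set (t4 := t2 + (Rabs B + 1) / (4 * q)).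
    assert (Ht4 : t2 < t4).
    { unfold t4; pose proof (Rabs_pos B).
      assert (0 < (Rabs B + 1) / (4 * q)) by (apply Rdiv_lt_0_compat; lra); lra. }
    assert (Hfast : forall t, t4 <= t -> 1 <= y1 t).
    { intros t Ht; assert (Ht' : t2 <= t) by lra.
      pose proof (HE t Ht') as HEt; fold B in HEt; pose proof (Hp t Ht').
      assert (4 * q * (t4 - t2) = Rabs B + 1) by (unfold t4; field; lra).
      assert (4 * q * (t4 - t2) <= 4 * q * (t - t2)) by (apply Rmult_le_compat_l; lra).
      pose proof (Rle_abs (- B)); rewrite Rabs_Ropp in *.
      unfold En at 1 in HEt; pose proof (pow2_ge_0 (y t)).
      destruct (Rle_lt_dec 1 (y1 t)); [assumption|exfalso; nra]. }
    (* At speed at least [1], a time [- y t4] suffices to climb from [y t4] to [0]. *)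
    assert (1 * ((t4 - y t4) - t4) <= y (t4 - y t4) - y t4).
    { pose proof (Hn t4); apply (growth_of_derive y y1); [lra| |].
      - intros; apply (sol_d1 _ _ _ _ H).
      - intros; apply Hfast; lra. }
    pose proof (Hn t4); pose proof (Hn (t4 - y t4)); lra. }
  destruct Hpos as [t5 [Ht5 Hy5]].
  destruct (IVT_gen y t2 t5 0) as [c [Hc H0]].
  - intros u; apply (sol_continuity _ _ _ _ _ H).
  - rewrite Rmin_left, Rmax_right by lra; lra.
  - rewrite Rmin_left, Rmax_right in Hc by lra.
    assert (Hc' : t2 <= c) by lra.
    destruct (Rn_pos_signs _ _ _ _ (HR c Hc') (Hp c Hc')) as [HD _].
    exists c; repeat split; auto; lra.
Qed.

(* Here [1 - E^2] is the derivative of the cubic. *)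
Lemma ivp_quartic tau y y1 y2 y3 t : ivp tau y y1 y2 y3 ->
  4 * En y y1 t * cubic tau (En y y1 t) + (1 - En y y1 t ^ 2) ^ 2 = 16 * Rn y y1 y2 t ^ 2.
Proof.
  intros H; destruct (ivp_integrals _ _ _ _ _ t H) as [H1 H2].
  rewrite <- H2, Rn_Qn.
  replace (1 - En y y1 t ^ 2) with (- (4 * y t * Qn y y1 y2 t)) by lra.
  unfold En; ring.
Qed.

Lemma ivp_regular tau y y1 y2 y3 : ivp tau y y1 y2 y3 -> 0 < tau -> 3 * tau ^ 2 <> 1 ->
  forall t, 0 < Qn y y1 y2 t /\ 0 < y1 t.
Proof.
  intros H Htau Hne.
  assert (HQ : forall t, Qn y y1 y2 t <> 0).
  { intros t H0; apply Hne; eapply ivp_Qn_zero; eauto. }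
  destruct H as [H [Hy [Hy1 Hy2]]]; intros t; split.
  - apply (pos_everywhere _ 0); auto.
    + intros; apply (sol_continuity _ _ _ _ _ H).
    + unfold Qn; rewrite Hy, Hy1, Hy2; lra.
  - apply (pos_everywhere y1 0).
    + intros; apply (sol_continuity _ _ _ _ _ H).
    + intros u H0; apply (HQ u); unfold Qn; rewrite H0; ring.
    + lra.
Qed.

(** For [t <= 0] the energy is confined to [[-3, 1]], which bounds [y], [y1] and, from below, [Qn].
    Hence [Rn' = Qn^2 / y1^2] has a positive lower bound, against [Rn > 0]. *)
Lemma ivp_supercritical tau y y1 y2 y3 : 0 < tau -> 1 < 3 * tau ^ 2 -> ~ ivp tau y y1 y2 y3.
Proof.
  intros Htau Hlarge H.
  assert (Hreg : forall t, 0 < Qn y y1 y2 t /\ 0 < y1 t) by (apply (ivp_regular tau _ _ _ y3); auto; lra).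
  pose proof H as [Hs [Hy [Hy1 Hy2]]].
  assert (HE1 : forall t, t <= 0 -> En y y1 t <= 1).
  { intros t Ht; replace 1 with (En y y1 0) by (unfold En; rewrite Hy, Hy1; ring).
    eapply nondecreasing_of_derive; [exact Ht| |].
    - intros; eapply is_derive_En, Hs.
    - intros u Hu; destruct (Hreg u) as [HQ Hp]; unfold Qn in HQ.
      assert (0 <= y2 u - y u); [|nra].
      destruct (Rle_lt_dec 0 (y2 u - y u)); [assumption|].
      pose proof (pow_lt _ 2 Hp); nra. }
  assert (HE3 : forall t, t <= 0 -> -3 <= En y y1 t).
  { intros t Ht; pose proof (ivp_quartic _ _ _ _ _ t H) as HG; unfold cubic in HG.
    pose proof (pow2_ge_0 (Rn y y1 y2 t)); specialize (HE1 t Ht).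
    set (E := En y y1 t) in *; destruct (Rle_lt_dec (-3) E) as [|HE]; [assumption|exfalso].
    assert (9 < E ^ 2) by nra.
    assert (0 <= - E ^ 4 / 3 + 2 * E ^ 2 + 4 * (4 * tau ^ 2 - 2 / 3) * E + 1) by nra.
    assert (E * (4 * tau ^ 2 - 2 / 3) <= 0) by nra.
    nra. }
  (* [cubic tau E = (E + 1)^2 (2 - E) / 3 + 4 m], so [Qn^2 >= m] as long as [E <= 2]. *)
  set (m := tau ^ 2 - 1 / 3).
  assert (Hm : 0 < m) by (unfold m; lra).
  assert (HQm : forall t, t <= 0 -> m <= Qn y y1 y2 t ^ 2).
  { intros t Ht; destruct (ivp_integrals _ _ _ _ _ t H) as [_ HF].
    specialize (HE1 t Ht); unfold cubic in HF; set (E := En y y1 t) in *.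
    assert (0 <= (E + 1) ^ 2 * (2 - E)) by (apply Rmult_le_pos; [apply pow2_ge_0|lra]).
    unfold m; nra. }
  (* From [|4 y Qn| = |E^2 - 1| <= 8] follows [y^2 <= 4 / m], hence [y1^2 = E + y^2 <= 1 + 4 / m],
     and [c] is a lower bound of [Qn^2 / y1^2]. *)
  set (c := m / (1 + 4 / m)).
  assert (H4m : 0 < 4 / m) by (apply Rdiv_lt_0_compat; lra).
  assert (Hc : 0 < c) by (unfold c; apply Rdiv_lt_0_compat; lra).
  assert (HR' : forall t, t <= 0 -> c <= ((y2 t - y t) * y1 t) ^ 2).
  { intros t Ht; destruct (Hreg t) as [HQ Hp]; specialize (HQm t Ht).
    destruct (ivp_integrals _ _ _ _ _ t H) as [Hint _].
    assert (Hy2m : y t ^ 2 <= 4 / m).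
    { apply Rmult_le_reg_r with m; [exact Hm|].
      replace (4 / m * m) with 4 by (field; lra).
      apply Rle_trans with (y t ^ 2 * Qn y y1 y2 t ^ 2).
      - apply Rmult_le_compat_l; [apply pow2_ge_0|exact HQm].
      - assert (Habs : (4 * y t * Qn y y1 y2 t) ^ 2 <= 8 ^ 2); [|lra].
        rewrite Hint; specialize (HE1 t Ht); specialize (HE3 t Ht).
        apply pow_maj_Rabs, Rabs_le; nra. }
    assert (Hp2 : y1 t ^ 2 <= 1 + 4 / m).
    { specialize (HE1 t Ht); unfold En in HE1; lra. }
    unfold c; apply Rmult_le_reg_r with (1 + 4 / m); [lra|].
    unfold Rdiv at 1; rewrite Rmult_assoc, Rinv_l, Rmult_1_r by lra.
    apply Rle_trans with (1 := HQm).
    replace (Qn y y1 y2 t ^ 2) with (((y2 t - y t) * y1 t) ^ 2 * y1 t ^ 2) by (unfold Qn; ring).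
    apply Rmult_le_compat_l; [apply pow2_ge_0|exact Hp2]. }
  (* Going back by [tau / c] uses up the whole value [Rn = tau] at time [0]. *)
  set (s := - (tau / c)).
  assert (Hs0 : s < 0) by (unfold s; pose proof (Rdiv_lt_0_compat _ _ Htau Hc); lra).
  assert (Hgrow : c * (0 - s) <= Rn y y1 y2 0 - Rn y y1 y2 s).
  { eapply growth_of_derive; [lra| |].
    - intros; eapply is_derive_Rn, Hs.
    - intros t Ht; apply HR'; lra. }
  assert (c * (0 - s) = tau) by (unfold s; field; lra).
  assert (Rn y y1 y2 0 = tau) by (unfold Rn; rewrite Hy, Hy1, Hy2; ring).
  assert (0 < Rn y y1 y2 s); [|lra].
  rewrite Rn_Qn; destruct (Hreg s); now apply Rmult_lt_0_compat.
Qed.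

(** * Uniqueness for subcritical data *)

Lemma primitive_exists g a b s0 :
  a < s0 < b -> (forall s, a < s < b -> continuity_pt g s) ->
  exists P, P s0 = 0 /\ forall s, a < s < b -> is_derive P s (g s).
Proof.
  intros Hs0 Hg; exists (fun s => RInt g s0 s); split; [exact (RInt_point s0 g)|].
  assert (Hint : forall s, a < s < b -> is_RInt g s0 s (RInt g s0 s)).
  { intros s Hs; apply (@RInt_correct R_CompleteNormedModule), (@ex_RInt_continuous R_CompleteNormedModule).
    intros z Hz; apply continuity_pt_filterlim, Hg.
    pose proof (Rmin_glb_lt s0 s a); pose proof (Rmax_lub_lt s0 s b); lra. }
  intros s Hs; apply (is_derive_RInt g _ s0).
  - destruct (open_and _ _ (open_gt a) (open_lt b) s Hs) as [eps Heps].
    exists eps; intros x Hx; apply Hint; apply (Heps x Hx).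
  - apply continuity_pt_filterlim, Hg, Hs.
Qed.

(** Separation of variables: for a primitive [P] of [1 / f], the function [P (S t) - t] is constant
    along each solution, and [P] is strictly increasing. *)
Lemma autonomous_unique f a b S1 S2 :
  (forall s, a < s < b -> 0 < f s) -> (forall s, a < s < b -> continuity_pt f s) ->
  (forall t, a < S1 t < b) -> (forall t, a < S2 t < b) ->
  (forall t, is_derive S1 t (f (S1 t))) -> (forall t, is_derive S2 t (f (S2 t))) ->
  S1 0 = S2 0 -> forall t, S1 t = S2 t.
Proof.
  intros Hpos Hcont H1 H2 HS1 HS2 H0.
  destruct (primitive_exists (fun s => / f s) a b (S1 0)) as [P [_ HP]].
  - apply H1.
  - intros s Hs; apply continuity_pt_inv; [now apply Hcont|].
    pose proof (Hpos s Hs); lra.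
  - assert (Hlin : forall S, (forall t, a < S t < b) -> (forall t, is_derive S t (f (S t))) ->
      forall t, P (S t) = P (S 0) + t).
    { intros S HS HS'.
      assert (Hc : forall t, P (S t) - t = P (S 0) - 0).
      { intros t; apply (constant_of_derive (fun t => P (S t) - t)); clear t; intros t.
        evar_last.
        - apply (@is_derive_minus R_AbsRing R_NormedModule).
          + apply (is_derive_comp P S); [apply HP, HS|apply HS'].
          + apply (@is_derive_id R_AbsRing).
        - pose proof (Hpos _ (HS t)).
          unfold scal, minus, plus, opp, one; simpl; unfold mult; simpl; field; lra. }
      intros t; specialize (Hc t); lra. }
    assert (Hinj : forall s t, a < s -> s < t -> t < b -> P s < P t).
    { intros s t Hs Hst Ht.
      destruct (MVT_cor2 P (fun s => / f s) s t Hst) as [c [Heq Hc]].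
      - intros; apply is_derive_Reals, HP; lra.
      - assert (0 < / f c) by (apply Rinv_0_lt_compat, Hpos; lra); nra. }
    intros t; pose proof (Hlin S1 H1 HS1 t) as E1; pose proof (Hlin S2 H2 HS2 t) as E2.
    rewrite H0 in E1; pose proof (H1 t); pose proof (H2 t).
    destruct (Rtotal_order (S1 t) (S2 t)) as [Hlt|[Heq|Hgt]]; [|exact Heq|].
    + pose proof (Hinj (S1 t) (S2 t)); lra.
    + pose proof (Hinj (S2 t) (S1 t)); lra.
Qed.

(** The [G] of the header; by [ivp_quartic] it is [16 Rn^2] along a solution. *)
Definition quartic tau E := 4 * E * cubic tau E + (1 - E ^ 2) ^ 2.

(** The signs at [-1], [1] and [2] locate [a] and [b]. The cubic has no quadratic term, so its third
    root is [- (a + b)], and [0 < 2 * a + b] places that root below [a]. *)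
Lemma cubic_roots tau : 0 < tau -> 3 * tau ^ 2 < 1 ->
  exists a b, -1 < a < 1 /\ 1 < b < 2 /\ a ^ 2 + a * b + b ^ 2 = 3 /\ 0 < 2 * a + b /\
    forall E, cubic tau E = (E - a) * (b - E) * ((E + a + b) / 3).
Proof.
  intros Htau Hsmall.
  assert (Hcont : continuity (cubic tau)).
  { intros E; apply (is_derive_continuity _ _ (- E ^ 2 + 1)).
    unfold cubic; auto_derive; [easy|field]. }
  assert (Fm1 : cubic tau (-1) < 0) by (unfold cubic; nra).
  assert (F1 : 0 < cubic tau 1) by (unfold cubic; nra).
  assert (F2 : cubic tau 2 < 0) by (unfold cubic; nra).
  destruct (IVT_gen (cubic tau) (-1) 1 0 Hcont) as [a [Ha Fa]].
  { rewrite Rmin_left, Rmax_right by lra; lra. }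
  destruct (IVT_gen (cubic tau) 1 2 0 Hcont) as [b [Hb Fb]].
  { rewrite Rmin_right, Rmax_left by lra; lra. }
  rewrite Rmin_left, Rmax_right in Ha by lra; rewrite Rmin_left, Rmax_right in Hb by lra.
  assert (a <> -1) by (intros ->; lra); assert (a <> 1) by (intros ->; lra).
  assert (b <> 1) by (intros ->; lra); assert (b <> 2) by (intros ->; lra).
  assert (Hab : a ^ 2 + a * b + b ^ 2 = 3).
  { apply Rmult_eq_reg_l with (b - a); [|lra]; unfold cubic in Fa, Fb; lra. }
  exists a, b; split; [lra|]; split; [lra|]; split; [exact Hab|]; split; [nra|].
  intros E; transitivity (cubic tau E - cubic tau a); [lra|].
  transitivity ((E - a) * ((a ^ 2 + a * b + b ^ 2) - E ^ 2 - E * a - a ^ 2) / 3).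
  - rewrite Hab; unfold cubic; field.
  - field.
Qed.

Lemma is_derive_quartic tau E : is_derive (quartic tau) E (4 * cubic tau E).
Proof. unfold quartic, cubic; auto_derive; [easy|field]. Qed.

(** The value at [a] is [(1 - a^2)^2 > 0], and the derivative [4 * cubic tau E] is positive between
    [a] and [b]. *)
Lemma quartic_pos tau a b : -1 < a < 1 -> cubic tau a = 0 -> (forall E, a < E < b -> 0 < cubic tau E) ->
  forall E, a <= E <= b -> 0 < quartic tau E.
Proof.
  intros Ha Fa Hpos E HE.
  assert (Ga : 0 < quartic tau a) by (unfold quartic; rewrite Fa; assert (0 < (1 - a ^ 2) ^ 2) by (apply pow_lt; nra); lra).
  assert (quartic tau a <= quartic tau E); [|lra].
  apply (nondecreasing_of_derive (quartic tau) (fun E => 4 * cubic tau E)); [lra| |].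
  - intros; apply is_derive_quartic.
  - intros t Ht; pose proof (Hpos t); lra.
Qed.

Lemma stays_between f a b : (forall t, continuity_pt f t) ->
  (forall t, f t <> a) -> (forall t, f t <> b) -> a < f 0 < b -> forall t, a < f t < b.
Proof.
  intros Hf Ha Hb H0 t; split.
  - assert (0 < f t - a); [|lra].
    apply (pos_everywhere (fun t => f t - a) 0); [|intros u Hu; apply (Ha u); lra|lra].
    intros u; apply continuity_pt_minus; [apply Hf|apply continuity_pt_const; now intros ? ?].
  - assert (0 < b - f t); [|lra].
    apply (pos_everywhere (fun t => b - f t) 0); [|intros u Hu; apply (Hb u); lra|lra].
    intros u; apply continuity_pt_minus; [apply continuity_pt_const; now intros ? ?|apply Hf].
Qed.

(** The energy starts at [1] and cannot cross a root of the cubic, because [4 Qn^2] never vanishes.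
    It therefore obeys one autonomous equation between [a] and [b], and [y] is an explicit function
    of it. *)
Lemma ivp_regular_unique tau y y1 y2 y3 z z1 z2 z3 : 0 < tau -> 3 * tau ^ 2 < 1 ->
  ivp tau y y1 y2 y3 -> ivp tau z z1 z2 z3 -> forall t, y t = z t.
Proof.
  intros Htau Hsmall.
  destruct (cubic_roots tau Htau Hsmall) as [a [b [Ha [Hb [Hab [Hab' HF]]]]]].
  assert (HFpos : forall E, a < E < b -> 0 < cubic tau E).
  { intros E HE; rewrite HF; repeat apply Rmult_lt_0_compat; lra. }
  assert (HGpos : forall E, a < E < b -> 0 < quartic tau E).
  { intros E HE; apply (quartic_pos tau a b); auto; [rewrite HF; ring|lra]. }
  set (f := fun E => 2 * cubic tau E / sqrt (quartic tau E)).
  assert (Hflow : forall y y1 y2 y3, ivp tau y y1 y2 y3 ->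
    (forall t, a < En y y1 t < b) /\ (forall t, is_derive (En y y1) t (f (En y y1 t))) /\
    En y y1 0 = 1 /\
    forall t, y t = (En y y1 t ^ 2 - 1) / (2 * sqrt (cubic tau (En y y1 t)))).
  { clear - Htau Hsmall Ha Hb HF HFpos HGpos; intros y y1 y2 y3 H.
    pose proof (ivp_regular _ _ _ _ _ H Htau) as Hreg.
    pose proof H as [Hs [Hy [Hy1 Hy2]]].
    assert (HE0 : En y y1 0 = 1) by (unfold En; rewrite Hy, Hy1; ring).
    assert (Hne : forall t, cubic tau (En y y1 t) <> 0).
    { intros t; destruct (ivp_integrals _ _ _ _ _ t H) as [_ <-].
      destruct (Hreg ltac:(lra) t) as [HQ _]; nra. }
    assert (HE : forall t, a < En y y1 t < b).
    { apply stays_between.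
      - intros t; apply (sol_continuity _ _ _ _ t Hs).
      - intros t Heq; apply (Hne t); rewrite Heq, HF; ring.
      - intros t Heq; apply (Hne t); rewrite Heq, HF; ring.
      - lra. }
    split; [exact HE|]; split; [|split; [exact HE0|]]; intros t;
      destruct (Hreg ltac:(lra) t) as [HQ Hp]; destruct (ivp_integrals _ _ _ _ _ t H) as [H1 H2].
    - evar_last; [eapply is_derive_En, Hs|].
      unfold f; replace (sqrt (quartic tau (En y y1 t))) with (4 * Rn y y1 y2 t).
      + rewrite <- H2, Rn_Qn; unfold Qn in *; field; split; [lra|].
        intros H0; rewrite H0 in HQ; lra.
      + symmetry; apply sqrt_lem_1.
        * apply Rlt_le, HGpos, HE.
        * rewrite Rn_Qn; pose proof (Rmult_lt_0_compat _ _ HQ Hp); lra.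
        * unfold quartic; rewrite (ivp_quartic _ _ _ _ _ t H); ring.
    - replace (sqrt (cubic tau (En y y1 t))) with (2 * Qn y y1 y2 t).
      + rewrite <- H1; field; lra.
      + symmetry; apply sqrt_lem_1; [apply Rlt_le, HFpos, HE|lra|rewrite <- H2; ring]. }
  intros Hy Hz t.
  destruct (Hflow _ _ _ _ Hy) as [Ey [dEy [Ey0 Ry]]].
  destruct (Hflow _ _ _ _ Hz) as [Ez [dEz [Ez0 Rz]]].
  rewrite Ry, Rz.
  replace (En z z1 t) with (En y y1 t); [reflexivity|].
  apply (autonomous_unique f a b); auto.
  - intros s Hs; apply Rdiv_lt_0_compat; [pose proof (HFpos s Hs); lra|apply sqrt_lt_R0; auto].
  - intros s Hs; unfold f; apply continuity_pt_div.
    + apply continuity_pt_mult; [apply continuity_pt_const; now intros ? ?|].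
      apply (is_derive_continuity _ _ (- s ^ 2 + 1)); unfold cubic; auto_derive; [easy|field].
    + apply (continuity_pt_comp (quartic tau) sqrt).
      * eapply is_derive_continuity, is_derive_quartic.
      * apply continuity_pt_sqrt, Rlt_le; auto.
    + apply Rgt_not_eq, sqrt_lt_R0; auto.
  - congruence.
Qed.

(** * The equation [x'' = x] and the case [tau = 0] *)

Lemma second_order_linear (y y1 : R -> R) :
  (forall t, is_derive y t (y1 t)) -> (forall t, is_derive y1 t (y t)) ->
  forall t, y t = (y 0 + y1 0) / 2 * exp t + (y 0 - y1 0) / 2 * exp (- t).
Proof.
  intros H1 H2 t.
  assert (Hp : forall t, (y t + y1 t) * exp (- t) = (y 0 + y1 0) * exp (- 0)).
  { intros s; apply (constant_of_derive (fun t => (y t + y1 t) * exp (- t))); clear s; intros s.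
    auto_derive; [repeat split; eexists; auto|].
    specialize (H1 s); specialize (H2 s); rewrite_derive H1; rewrite_derive H2; ring. }
  assert (Hm : forall t, (y t - y1 t) * exp t = (y 0 - y1 0) * exp 0).
  { intros s; apply (constant_of_derive (fun t => (y t - y1 t) * exp t)); clear s; intros s.
    auto_derive; [repeat split; eexists; auto|].
    specialize (H1 s); specialize (H2 s); rewrite_derive H1; rewrite_derive H2; ring. }
  specialize (Hp t); specialize (Hm t); rewrite Ropp_0, exp_0 in *.
  assert (Hinv : exp t * exp (- t) = 1) by (rewrite <- exp_plus, Rplus_opp_r; apply exp_0).
  assert (E1 : y t + y1 t = (y 0 + y1 0) * exp t).
  { transitivity ((y t + y1 t) * exp (- t) * exp t); [|rewrite Hp; ring].
    rewrite Rmult_assoc, (Rmult_comm (exp (- t))), Hinv; ring. }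
  assert (E2 : y t - y1 t = (y 0 - y1 0) * exp (- t)).
  { transitivity ((y t - y1 t) * exp t * exp (- t)); [|rewrite Hm; ring].
    rewrite Rmult_assoc, Hinv; ring. }
  lra.
Qed.

(** For [tau = 0] the cubic is [- (E - 1)^2 (E + 2) / 3], and it equals [4 Qn^2 >= 0]. The energy
    starts at [1] and cannot pass [0], so it is positive, whence [Qn = 0], [y1 <> 0] and
    [y2 = y]. *)
Lemma ivp_zero_sinh y y1 y2 y3 : ivp 0 y y1 y2 y3 -> forall t, y t = sinh t.
Proof.
  intros H; pose proof H as [Hs [Hy [Hy1 Hy2]]].
  assert (HE0 : En y y1 0 = 1) by (unfold En; rewrite Hy, Hy1; ring).
  assert (HF : forall t, 4 * Qn y y1 y2 t ^ 2 = (1 - En y y1 t) ^ 2 * (- (En y y1 t + 2)) / 3).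
  { intros t; destruct (ivp_integrals _ _ _ _ _ t H) as [_ ->]; unfold cubic; field. }
  assert (HEpos : forall t, 0 < En y y1 t).
  { apply (pos_everywhere _ 0).
    - intros t; apply (sol_continuity _ _ _ _ t Hs).
    - intros t Ht; pose proof (HF t) as Hft; rewrite Ht in Hft.
      pose proof (pow2_ge_0 (Qn y y1 y2 t)); lra.
    - lra. }
  assert (HD : forall t, y2 t = y t).
  { intros t; specialize (HF t); specialize (HEpos t).
    pose proof (pow2_ge_0 (Qn y y1 y2 t)); pose proof (pow2_ge_0 (1 - En y y1 t)).
    assert (HQ0 : Qn y y1 y2 t = 0) by nra.
    assert (Hp : y1 t <> 0) by (intros Hz; unfold En in HEpos; rewrite Hz in HEpos; nra).
    unfold Qn in HQ0; apply Rmult_integral in HQ0; destruct HQ0 as [|HQ0]; [lra|].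
    exfalso; revert HQ0; now apply pow_nonzero. }
  intros t; rewrite (second_order_linear y y1), Hy, Hy1.
  - unfold sinh; field.
  - apply Hs.
  - intros u; rewrite <- HD; apply Hs.
Qed.

(** * Uniqueness for critical data *)

Lemma zero_from_right f c d : c < d -> continuity_pt f c ->
  (forall t, c < t < d -> f t = 0) -> f c = 0.
Proof.
  intros Hcd Hf H0; apply NNPP; intros Hne.
  destruct (continuity_pos_near (fun t => f t ^ 2) c) as [e [He Hnear]].
  - apply (continuity_pt_comp f (fun x => x ^ 2)); [exact Hf|].
    apply derivable_continuous_pt, derivable_pt_pow.
  - apply pow2_gt_0, Hne.
  - set (t := c + Rmin e (d - c) / 2).
    assert (0 < Rmin e (d - c)) by (apply Rmin_pos; lra).
    pose proof (Rmin_l e (d - c)); pose proof (Rmin_r e (d - c)).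
    assert (Hft : 0 < f t ^ 2) by (apply Hnear, Rabs_def1; unfold t; lra).
    rewrite H0 in Hft; [lra|unfold t; lra].
Qed.

(* On the level set of the critical solution [cubic] is [(E + 1)^2 (2 - E) / 3]; this set also
   contains [cosh], with [E = -1], and these relations, obtained by dividing by powers of
   [E + 1], cut out the other component. *)
Definition critical_relations (y y1 y2 : R -> R) t :=
  4 * (2 - En y y1 t) * y1 t ^ 2 = (3 - En y y1 t) * (En y y1 t + 1) /\
  y t * (y2 t - y t) * (3 - En y y1 t) = (2 - En y y1 t) * (En y y1 t - 1) /\
  3 * (y2 t - y t) ^ 2 * (3 - En y y1 t) ^ 2 = 4 * (2 - En y y1 t) ^ 3.

Lemma ivp_critical_integrals tau y y1 y2 y3 t : ivp tau y y1 y2 y3 -> 3 * tau ^ 2 = 1 ->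
  4 * y t * Qn y y1 y2 t = (En y y1 t - 1) * (En y y1 t + 1) /\
  12 * Qn y y1 y2 t ^ 2 = (En y y1 t + 1) ^ 2 * (2 - En y y1 t).
Proof.
  intros H Htau; destruct (ivp_integrals _ _ _ _ _ t H) as [H1 H2].
  split; [lra|]; unfold cubic in H2; nra.
Qed.

Lemma critical_relations_regular tau y y1 y2 y3 t : ivp tau y y1 y2 y3 -> 3 * tau ^ 2 = 1 ->
  Qn y y1 y2 t <> 0 -> critical_relations y y1 y2 t.
Proof.
  intros H Htau HQ; destruct (ivp_critical_integrals _ _ _ _ _ t H Htau) as [H1 H2].
  assert (HE : y1 t ^ 2 = En y y1 t + y t ^ 2) by (unfold En; ring).
  assert (HQ1 : Qn y y1 y2 t = (y2 t - y t) * y1 t ^ 2) by reflexivity.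
  unfold critical_relations.
  set (E := En y y1 t) in *; set (q := Qn y y1 y2 t) in *; set (D := y2 t - y t) in *.
  set (p := y1 t) in *; set (x := y t) in *; clearbody E q D p x.
  assert (HE1 : E + 1 <> 0).
  { intros H0; rewrite H0 in H2; apply HQ; nra. }
  assert (Hx : 4 * x ^ 2 * (2 - E) = 3 * (E - 1) ^ 2).
  { apply Rmult_eq_reg_l with ((E + 1) ^ 2); [|now apply pow_nonzero].
    transitivity (4 * x ^ 2 * (12 * q ^ 2)); [rewrite H2; ring|].
    transitivity (3 * (4 * x * q) ^ 2); [ring|rewrite H1; ring]. }
  assert (Ha : 4 * (2 - E) * p ^ 2 = (3 - E) * (E + 1)) by (rewrite HE; lra).
  split; [exact Ha|]; split.
  - apply Rmult_eq_reg_l with (E + 1); [|exact HE1].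
    transitivity (x * D * (4 * (2 - E) * p ^ 2)); [rewrite Ha; ring|].
    transitivity ((2 - E) * (4 * x * q)); [rewrite HQ1; ring|rewrite H1; ring].
  - apply Rmult_eq_reg_l with ((E + 1) ^ 2); [|now apply pow_nonzero].
    transitivity (3 * D ^ 2 * (4 * (2 - E) * p ^ 2) ^ 2); [rewrite Ha; ring|].
    transitivity (4 * (2 - E) ^ 2 * (12 * q ^ 2)); [rewrite HQ1; ring|rewrite H2; ring].
Qed.

(** Where [Rn <> 0] the relations come from division. The zeros of [Rn] are negative times; at the
    last one, [c], the relations hold by continuity from the right. It remains to exclude earlier
    zeros, that is, that the solution sits on the [cosh] component before [c]. *)
Lemma critical_relations_everywhere tau y y1 y2 y3 t : ivp tau y y1 y2 y3 -> 0 < tau ->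
  3 * tau ^ 2 = 1 -> critical_relations y y1 y2 t.
Proof.
  intros H Htau Hcrit; pose proof H as [Hs [Hy [Hy1 Hy2]]].
  assert (Hreg : forall u, Rn y y1 y2 u <> 0 -> critical_relations y y1 y2 u).
  { intros u HR; eapply critical_relations_regular; eauto.
    intros HQ; apply HR; rewrite Rn_Qn, HQ; ring. }
  destruct (Req_dec (Rn y y1 y2 t) 0) as [HRt|HRt]; [|now apply Hreg].
  assert (HR0 : Rn y y1 y2 0 = tau) by (unfold Rn; rewrite Hy, Hy1, Hy2; ring).
  assert (Ht : t < 0).
  { destruct (Rlt_le_dec t 0) as [|Hle]; [assumption|].
    pose proof (Rn_nondecreasing _ _ _ _ 0 t Hs Hle); lra. }
  destruct (last_zero (Rn y y1 y2) t 0) as [c [Hc [Hc0 Hpos]]]; [lra| |lra|lra|].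
  { intros; apply (sol_continuity _ _ _ _ _ Hs). }
  assert (Hrc : critical_relations y y1 y2 c).
  { assert (Hnear : forall u, c < u < 0 -> critical_relations y y1 y2 u).
    { intros u Hu; apply Hreg; pose proof (Hpos u); lra. }
    assert (Hclose : forall P : R -> R, ex_derive P c ->
      (forall u, c < u < 0 -> P u = 0) -> P c = 0).
    { intros P [l Hl] H0; apply (zero_from_right P c 0); [lra| |exact H0].
      eapply is_derive_continuity, Hl. }
    pose proof (sol_d1 _ _ _ _ Hs c); pose proof (sol_d2 _ _ _ _ Hs c).
    pose proof (sol_d3 _ _ _ _ Hs c); pose proof (is_derive_En _ _ _ _ c Hs).
    repeat split; apply Rminus_diag_uniq.
    - apply (Hclose (fun u => 4 * (2 - En y y1 u) * y1 u ^ 2 - (3 - En y y1 u) * (En y y1 u + 1))).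
      + auto_derive; repeat split; eexists; eassumption.
      + intros u Hu; apply Rminus_diag_eq, (Hnear u Hu).
    - apply (Hclose (fun u => y u * (y2 u - y u) * (3 - En y y1 u)
                                - (2 - En y y1 u) * (En y y1 u - 1))).
      + auto_derive; repeat split; eexists; eassumption.
      + intros u Hu; apply Rminus_diag_eq, (Hnear u Hu).
    - apply (Hclose (fun u => 3 * (y2 u - y u) ^ 2 * (3 - En y y1 u) ^ 2
                                - 4 * (2 - En y y1 u) ^ 3)).
      + auto_derive; repeat split; eexists; eassumption.
      + intros u Hu; apply Rminus_diag_eq, (Hnear u Hu). }
  (* An earlier zero would make [Rn] vanish on all of [[t, c]] by monotonicity. As [y2 - y] is
     nonzero near [c], [y1] would vanish just left of [c], contradicting [y2 c <> 0]. *)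
  destruct (Req_dec t c) as [->|Htc]; [exact Hrc|exfalso].
  assert (HRleft : forall u, t <= u <= c -> Rn y y1 y2 u = 0).
  { intros u Hu; pose proof (Rn_nondecreasing _ _ _ _ t u Hs); 
      pose proof (Rn_nondecreasing _ _ _ _ u c Hs); lra. }
  assert (HEc : En y y1 c = -1).
  { rewrite Rn_Qn in Hc0; apply (ivp_Qn_zero tau y y1 y2 y3 c H); [|exact Htau].
    apply Rmult_integral in Hc0; destruct Hc0 as [|Hc0]; [assumption|].
    unfold Qn; rewrite Hc0; ring. }
  destruct Hrc as [Ra [Rb Rc]]; rewrite HEc in Ra, Rb, Rc.
  assert (Hpc : y1 c = 0) by nra.
  assert (HDc : y2 c - y c <> 0) by (intros H0; rewrite H0 in Rc; lra).
  (* With [E = -1] and [y1 = 0] one has [y^2 = 1], whereas [y2 = 0] in the second relation would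
     give [y^2 = 3 / 2]. *)
  assert (Hy2c : y2 c <> 0).
  { intros H0; unfold En in HEc; rewrite Hpc in HEc; rewrite H0 in Rb; nra. }
  assert (Hsq : forall f, continuity_pt f c -> f c <> 0 ->
    exists d, 0 < d /\ forall u, Rabs (u - c) < d -> f u <> 0).
  { intros f Hf Hne; destruct (continuity_pos_near (fun u => f u ^ 2) c) as [d [Hd Hnear]].
    - apply (continuity_pt_comp f (fun x => x ^ 2)); [exact Hf|].
      apply derivable_continuous_pt, derivable_pt_pow.
    - apply pow2_gt_0, Hne.
    - exists d; split; [exact Hd|]; intros u Hu H0; specialize (Hnear u Hu); rewrite H0 in Hnear; lra. }
  destruct (Hsq y2) as [d1 [Hd1 Hn1]]; [apply (sol_continuity _ _ _ _ c Hs)|exact Hy2c|].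
  destruct (Hsq (fun u => y2 u - y u)) as [d2 [Hd2 Hn2]]; [|exact HDc|].
  { apply continuity_pt_minus; apply (sol_continuity _ _ _ _ c Hs). }
  set (d := Rmin (c - t) (Rmin d1 d2)).
  assert (Hd : 0 < d) by (repeat apply Rmin_pos; lra).
  assert (Hdt : d <= c - t) by apply Rmin_l.
  assert (Hdd : d <= Rmin d1 d2) by apply Rmin_r.
  pose proof (Rmin_l d1 d2); pose proof (Rmin_r d1 d2).
  assert (Hpl : y1 (c - d / 2) = 0).
  { assert (HR : Rn y y1 y2 (c - d / 2) = 0) by (apply HRleft; lra).
    apply Rmult_integral in HR; destruct HR as [HR|HR].
    - exfalso; revert HR; apply (Hn2 (c - d / 2)), Rabs_def1; lra.
    - apply NNPP; intros Hne; revert HR; now apply pow_nonzero. }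
  destruct (MVT_cor2 y1 y2 (c - d / 2) c) as [v [Hv Hvc]]; [lra| |].
  - intros u _; apply is_derive_Reals, Hs.
  - rewrite Hpl, Hpc in Hv; apply (Hn1 v); [apply Rabs_def1; lra|].
    apply Rmult_eq_reg_r with (c - (c - d / 2)); lra.
Qed.

(** The rate of the coordinate [s] with [s^2 = E + 1]. Its zeros are simple and correspond to
    [E = 2]; it is smooth and positive at [s = 0], the double root [E = -1] of the cubic. *)
Definition crit_field s := (3 - s ^ 2) / (sqrt 3 * sqrt (4 - s ^ 2)).

(* A signed square root of [E + 1], which stays smooth where [y1] changes sign. *)
Definition crit_coord (y y1 : R -> R) t :=
  2 * y1 t * sqrt (2 - En y y1 t) / sqrt (3 - En y y1 t).

Lemma ivp_critical_flow tau y y1 y2 y3 t : ivp tau y y1 y2 y3 -> 0 < tau -> 3 * tau ^ 2 = 1 ->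
  En y y1 t < 2 /\ crit_coord y y1 t ^ 2 = En y y1 t + 1 /\
  is_derive (crit_coord y y1) t (crit_field (crit_coord y y1 t)).
Proof.
  intros H Htau Hcrit; pose proof H as [Hs [Hy [Hy1 Hy2]]].
  assert (Hrel : forall t, critical_relations y y1 y2 t).
  { intros; eapply critical_relations_everywhere; eauto. }
  assert (HE2 : forall t, En y y1 t < 2).
  { intros u; destruct (Hrel u) as [Ha _].
    destruct (ivp_critical_integrals _ _ _ _ _ u H Hcrit) as [_ HF].
    destruct (Rlt_le_dec (En y y1 u) 2) as [|Hle]; [assumption|exfalso].
    pose proof (pow2_ge_0 (Qn y y1 y2 u)); set (E := En y y1 u) in *.
    assert (9 <= (E + 1) ^ 2) by nra.
    (* [E > 2] would make [12 Qn^2] negative, and at [E = 2] the first relation reads [0 = 3]. *)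
    assert (HE : E = 2) by nra; rewrite HE in Ha; lra. }
  (* The third relation keeps [y2 - y] away from [0], so its sign at time [0] persists; this selects
     the square root in [HDw]. *)
  assert (HD : 0 < y2 t - y t).
  { apply (pos_everywhere (fun u => y2 u - y u) 0).
    - intros u; apply continuity_pt_minus; apply (sol_continuity _ _ _ _ u Hs).
    - intros u H0; destruct (Hrel u) as [_ [_ Hc]]; specialize (HE2 u); rewrite H0 in Hc.
      assert (0 < (2 - En y y1 u) ^ 3) by (apply pow_lt; lra); lra.
    - rewrite Hy, Hy2; lra. }
  specialize (Hrel t); destruct Hrel as [Ha [Hb Hc]]; specialize (HE2 t).
  split; [exact HE2|].
  (* In terms of [w], [v], [r] with [v^2 = 1 + w^2] and [r^2 = 3], the relations make [y], [y2 - y]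
     and [y1^2] rational, and the derivative becomes an algebraic identity. *)
  set (w := sqrt (2 - En y y1 t)); set (v := sqrt (3 - En y y1 t)); set (r := sqrt 3).
  assert (Hw : 0 < w) by (apply sqrt_lt_R0; lra).
  assert (Hv : 0 < v) by (apply sqrt_lt_R0; lra).
  assert (Hr : 0 < r) by (apply sqrt_lt_R0; lra).
  assert (Hw2 : w ^ 2 = 2 - En y y1 t) by (apply pow2_sqrt; lra).
  assert (Hv2 : v ^ 2 = 3 - En y y1 t) by (apply pow2_sqrt; lra).
  assert (Hr2 : r ^ 2 = 3) by (apply pow2_sqrt; lra).
  assert (Hp2 : y1 t ^ 2 = v ^ 2 * (3 - w ^ 2) / (4 * w ^ 2)).
  { apply Rmult_eq_reg_l with (4 * w ^ 2); [|nra].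
    transitivity ((3 - En y y1 t) * (En y y1 t + 1)).
    - rewrite Hw2; lra.
    - rewrite <- Hv2; replace (En y y1 t) with (2 - w ^ 2) by lra; field; lra. }
  assert (Hsq : crit_coord y y1 t ^ 2 = En y y1 t + 1).
  { unfold crit_coord; fold w v.
    transitivity (4 * y1 t ^ 2 * w ^ 2 / v ^ 2); [field; lra|].
    rewrite Hp2; transitivity (3 - w ^ 2); [field; lra|lra]. }
  split; [exact Hsq|].
  assert (HDw : y2 t - y t = 2 * w ^ 3 / (r * v ^ 2)).
  { rewrite <- Hw2, <- Hv2 in Hc.
    assert (H0 : ((y2 t - y t) * r * v ^ 2) ^ 2 = (2 * w ^ 3) ^ 2).
    { transitivity (r ^ 2 * (y2 t - y t) ^ 2 * (v ^ 2) ^ 2); [ring|].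
      rewrite Hr2, Hc; ring. }
    assert (H1 : (y2 t - y t) * r * v ^ 2 = 2 * w ^ 3).
    { apply Rsqr_inj; [| |now rewrite 2!Rsqr_pow2].
      - repeat apply Rmult_le_pos; try lra; apply pow2_ge_0.
      - pose proof (pow_lt _ 3 Hw); lra. }
    rewrite <- H1; field; lra. }
  assert (Hyw : y t = r * (1 - w ^ 2) / (2 * w)).
  { rewrite <- Hw2, <- Hv2, HDw in Hb; replace (En y y1 t - 1) with (1 - w ^ 2) in Hb by lra.
    apply Rmult_eq_reg_r with (2 * w ^ 3 / r).
    - transitivity (y t * (2 * w ^ 3 / (r * v ^ 2)) * v ^ 2); [field; lra|].
      rewrite Hb; field; lra.
    - apply Rgt_not_eq, Rdiv_lt_0_compat; [pose proof (pow_lt _ 3 Hw); lra|exact Hr]. }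
  pose proof (sol_d1 _ _ _ _ Hs t) as D1; pose proof (sol_d2 _ _ _ _ Hs t) as D2.
  pose proof (is_derive_En _ _ _ _ t Hs) as DE.
  unfold crit_field; rewrite Hsq.
  replace (4 - (En y y1 t + 1)) with (3 - En y y1 t) by ring; fold v r.
  unfold crit_coord; auto_derive.
  - repeat split; try (eexists; eassumption); try lra.
    change (v <> 0); lra.
  - rewrite_derive DE; rewrite_derive D2.
    replace (2 + - En y y1 t) with (2 - En y y1 t) by ring.
    replace (3 + - En y y1 t) with (3 - En y y1 t) by ring.
    fold w v; replace (y2 t) with (y t + (y2 t - y t)) at 1 by ring.
    transitivity (2 * (y t + (y2 t - y t)) * w / v
                   - 2 * y1 t ^ 2 * (y2 t - y t) * (v ^ 2 - w ^ 2) / (w * v ^ 3)); [field; lra|].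
    rewrite Hp2, HDw, Hyw; replace (3 - (En y y1 t + 1)) with (w ^ 2) by lra.
    replace (v ^ 2 - w ^ 2) with 1 by lra.
    transitivity ((r ^ 2 * (1 - w ^ 2) * v ^ 2 + 4 * w ^ 4 - (3 - w ^ 2)) / (r * v ^ 3));
      [field; lra|].
    rewrite Hr2; replace (3 * (1 - w ^ 2) * v ^ 2 + 4 * w ^ 4 - (3 - w ^ 2)) with (w ^ 2 * v ^ 2).
    + field; lra.
    + replace (v ^ 2) with (1 + w ^ 2) by lra; ring.
Qed.

(** Equal coordinates give equal energies, then equal [y1], since the coordinate is [y1] times a
    positive function of the energy; [y] follows from its derivative and its value at [0]. *)
Lemma ivp_critical_unique tau y y1 y2 y3 z z1 z2 z3 : 0 < tau -> 3 * tau ^ 2 = 1 ->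
  ivp tau y y1 y2 y3 -> ivp tau z z1 z2 z3 -> forall t, y t = z t.
Proof.
  intros Htau Hcrit Hy Hz.
  pose proof (fun t => ivp_critical_flow _ _ _ _ _ t Hy Htau Hcrit) as Fy.
  pose proof (fun t => ivp_critical_flow _ _ _ _ _ t Hz Htau Hcrit) as Fz.
  destruct Hy as [Hy [y0 [y10 _]]]; destruct Hz as [Hz [z0 [z10 _]]].
  assert (Hr : sqrt 3 ^ 2 = 3) by (apply pow2_sqrt; lra).
  assert (Hr0 : 0 < sqrt 3) by (apply sqrt_lt_R0; lra).
  assert (Hs : forall t, crit_coord y y1 t = crit_coord z z1 t).
  { apply (autonomous_unique crit_field (- sqrt 3) (sqrt 3)).
    - intros s Hs; apply Rdiv_lt_0_compat; [nra|].
      apply Rmult_lt_0_compat; [exact Hr0|apply sqrt_lt_R0; nra].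
    - intros s Hs; unfold crit_field; apply (is_derive_continuity _ _
        ((- 2 * s * (sqrt 3 * sqrt (4 - s ^ 2)) - (3 - s ^ 2) * (sqrt 3 * (- s / sqrt (4 - s ^ 2))))
          / (sqrt 3 * sqrt (4 - s ^ 2)) ^ 2)).
      assert (0 < 4 - s ^ 2) by nra.
      pose proof (sqrt_lt_R0 (4 - s ^ 2) ltac:(lra)) as Hpos.
      auto_derive; unfold Rminus in *; simpl in *.
      + split; [lra|split; [|easy]]; apply Rgt_not_eq, Rmult_lt_0_compat; lra.
      + field; lra.
    - intros t; destruct (Fy t) as [HE [Hsq _]]; split; nra.
    - intros t; destruct (Fz t) as [HE [Hsq _]]; split; nra.
    - intros t; apply Fy.
    - intros t; apply Fz.
    - unfold crit_coord, En; rewrite y0, z0, y10, z10; reflexivity. }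
  assert (H1 : forall t, y1 t = z1 t).
  { intros t; destruct (Fy t) as [HE [Hsq _]]; destruct (Fz t) as [HEz [Hsqz _]].
    pose proof (Hs t) as Hst; rewrite Hst in Hsq.
    assert (HEE : En y y1 t = En z z1 t) by lra.
    unfold crit_coord in Hst; rewrite HEE in Hst.
    assert (0 < sqrt (2 - En z z1 t)) by (apply sqrt_lt_R0; lra).
    assert (0 < sqrt (3 - En z z1 t)) by (apply sqrt_lt_R0; lra).
    apply Rmult_eq_reg_r with (2 * sqrt (2 - En z z1 t) / sqrt (3 - En z z1 t)).
    - unfold Rdiv in *; lra.
    - apply Rgt_not_eq, Rdiv_lt_0_compat; lra. }
  intros t.
  assert (Hc : y t - z t = y 0 - z 0).
  { apply (constant_of_derive (fun t => y t - z t)); clear t; intros t.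
    evar_last; [apply (@is_derive_minus R_AbsRing R_NormedModule); [apply Hy|apply Hz]|].
    rewrite H1; unfold minus, plus, opp; simpl; ring. }
  lra.
Qed.

(** * Linearisation of a flow at its end points *)

Lemma increasing_of_derive (U U' : R -> R) a b :
  (forall s, a < s < b -> is_derive U s (U' s)) -> (forall s, a < s < b -> 0 < U' s) ->
  forall s t, a < s -> s < t -> t < b -> U s < U t.
Proof.
  intros HU Hpos s t Hs Hst Ht.
  destruct (MVT_cor2 U U' s t Hst) as [c [Heq Hc]].
  - intros; apply is_derive_Reals, HU; lra.
  - assert (0 < U' c) by (apply Hpos; lra); nra.
Qed.

(** The inverse is picked pointwise by [epsilon]. Once it is differentiable, [V' = 1 / U' (V)]
    bootstraps to smoothness. *)
Lemma smooth_inverse (U U' : R -> R) lo b m :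
  (forall s, lo < s < b -> is_derive U s (U' s)) -> (forall s, lo < s < b -> 0 < U' s) ->
  Cinf (fun s => lo < s < b) U' ->
  (forall u, m < u -> exists s, lo < s < b /\ U s = u) ->
  exists V, (forall u, m < u -> lo < V u < b /\ U (V u) = u) /\
    (forall s, lo < s < b -> m < U s -> V (U s) = s) /\
    (forall u, m < u -> is_derive V u (/ U' (V u))) /\ Cinf (fun u => m < u) V.
Proof.
  intros HU Hpos HU' Hsurj.
  pose proof (increasing_of_derive U U' lo b HU Hpos) as Hincr.
  set (V := fun u => epsilon (inhabits 0) (fun s => lo < s < b /\ U s = u)).
  assert (HV : forall u, m < u -> lo < V u < b /\ U (V u) = u).
  { intros u Hu; exact (epsilon_spec (inhabits 0) _ (Hsurj u Hu)). }
  assert (Hinj : forall s t, lo < s < b -> lo < t < b -> U s = U t -> s = t).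
  { intros s t Hs Ht Heq; destruct (Rtotal_order s t) as [Hlt|[|Hgt]]; [|assumption|].
    - pose proof (Hincr s t); lra.
    - pose proof (Hincr t s); lra. }
  assert (Hord : forall u v, m < u -> u < v -> V u < V v).
  { intros u v Hu Huv; destruct (HV u Hu) as [Hu1 Hu2]; destruct (HV v) as [Hv1 Hv2]; [lra|].
    destruct (Rtotal_order (V u) (V v)) as [|[Heq|Hgt]]; [assumption| |].
    - rewrite Heq in Hu2; lra.
    - pose proof (Hincr (V v) (V u)); lra. }
  assert (Hordw : forall u v, m < u -> u <= v -> V u <= V v).
  { intros u v Hu [Huv| ->]; [apply Rlt_le, Hord; assumption|lra]. }
  assert (HV' : forall u, m < u -> is_derive V u (/ U' (V u))).
  { intros u Hu; set (u1 := (m + u) / 2); set (u2 := u + 1).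
    assert (Hu1 : m < u1 < u) by (unfold u1; lra); assert (Hu2 : u < u2) by (unfold u2; lra).
    destruct (HV u1) as [A1 B1]; [lra|]; destruct (HV u2) as [A2 B2]; [lra|].
    destruct (HV u Hu) as [A B].
    assert (Hlt : V u1 < V u2) by (apply Hord; lra).
    assert (Hex : derivable_pt V u).
    { assert (Hwf : forall x, U (V u1) <= x -> x <= U (V u2) -> V u1 <= V x <= V u2).
      { rewrite B1, B2; intros x Hx1 Hx2; split.
        - apply Hordw; lra.
        - apply Hordw; lra. }
      assert (Hder : forall s, V u1 <= s <= V u2 -> derivable_pt U s).
      { intros s Hs; exists (U' s); apply is_derive_Reals, HU; lra. }
      assert (Henc : U (V u1) < u < U (V u2)) by lra.
      apply (derivable_pt_recip_interv U V (V u1) (V u2) u Hlt Henc) with (g_wf := Hwf) (f_derivable := Hder).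
      - rewrite B1, B2; intros x Hx1 Hx2; unfold comp, id; apply (HV x ltac:(lra)).
      - intros; apply Hincr; lra.
      - rewrite Derive_Reals, (is_derive_unique _ _ _ (HU (V u) A)).
        apply Rgt_not_eq, Hpos, A. }
    destruct Hex as [l Hl]; apply is_derive_Reals in Hl.
    assert (Hcomp : is_derive (fun x => U (V x)) u (l * U' (V u))).
    { apply (is_derive_comp U V); auto. }
    assert (Hid : is_derive (fun x => U (V x)) u 1).
    { apply (is_derive_ext_loc (fun x => x)); [|apply (@is_derive_id R_AbsRing)].
      destruct (open_gt m u Hu) as [eps Heps]; exists eps; intros x Hx; symmetry; apply HV, (Heps x Hx). }
    apply is_derive_unique in Hcomp; apply is_derive_unique in Hid; rewrite Hcomp in Hid.
    replace (/ U' (V u)) with l; [exact Hl|].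
    pose proof (Hpos _ A); apply Rmult_eq_reg_r with (U' (V u)); [|lra].
    rewrite Rinv_l; lra. }
  exists V; split; [exact HV|]; split; [|split; [exact HV'|]].
  - intros s Hs Hm; destruct (HV (U s) Hm) as [A B]; now apply Hinj.
  - apply (Cn_bootstrap _ V (fun u => / U' (V u)) HV').
    intros n Hn; apply (Cn_inv n _ (fun u => U' (V u))).
    + intros u Hu; apply Rgt_not_eq, Hpos, HV, Hu.
    + apply (Cn_comp n _ (fun s => lo < s < b)); [intros; now apply HV|apply HU'|exact Hn].
Qed.

Lemma Cinf_continuity (U : R -> Prop) f x : Cinf U f -> U x -> continuity_pt f x.
Proof.
  intros Hf Hx; destruct (Hf 1%nat) as [g [Hg _]]; eapply is_derive_continuity, Hg, Hx.
Qed.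

(* [U] linearises the vector field [(s - a) (b - s) k / sqrt G] at its simple zero [a].  The
   hypothesis on [G] makes [sqrt G / ((s - a) (b - s) k) - 1 / (s - a)] smooth at [a]:
   it is [W / (h (sqrt G + h))] with [h = (b - s) k]. *)
Lemma linearisation lo a s0 b G k W :
  lo < a -> a < s0 -> s0 < b ->
  Cinf (fun s => lo < s < b) G -> Cinf (fun s => lo < s < b) k ->
  Cinf (fun s => lo < s < b) W ->
  (forall s, lo < s < b -> 0 < G s) -> (forall s, lo < s < b -> 0 < k s) ->
  (forall s, lo < s < b -> G s = ((b - s) * k s) ^ 2 + (s - a) * W s) ->
  exists U U' p : R -> R,
    (forall s, lo < s < b -> is_derive U s (U' s)) /\
    (forall s, lo < s < b -> 0 < U' s) /\ Cinf (fun s => lo < s < b) U' /\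
    U s0 = 1 /\
    Cinf (fun s => lo < s < b) p /\ (forall s, lo < s < b -> 0 < p s) /\
    (forall s, lo < s < b -> s - a = U s * p s) /\
    (forall s, a < s < b -> U' s = U s * (sqrt (G s) / ((s - a) * (b - s) * k s))).
Proof.
  intros Hlo Ha Hb HG Hk HW HGpos Hkpos HGW.
  set (h := fun s => (b - s) * k s).
  assert (Hh : forall s, lo < s < b -> 0 < h s).
  { intros s Hs; apply Rmult_lt_0_compat; [lra|auto]. }
  assert (Hsq : forall s, lo < s < b -> 0 < sqrt (G s)) by (intros; apply sqrt_lt_R0; auto).
  set (r := fun s => W s / (h s * (sqrt (G s) + h s))).
  assert (Hhs : Cinf (fun s => lo < s < b) h).
  { intros n; apply Cn_mult; [apply Cn_minus; [apply Cn_const|apply Cn_id]|apply Hk]. }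
  assert (Hr : Cinf (fun s => lo < s < b) r).
  { intros n; apply Cn_div; [|apply HW|apply Cn_mult; [apply Hhs|apply Cn_plus; [|apply Hhs]]].
    - intros s Hs; pose proof (Hh s Hs); pose proof (Hsq s Hs).
      apply Rgt_not_eq, Rmult_lt_0_compat; lra.
    - apply Cn_sqrt; [exact HGpos|apply HG]. }
  destruct (primitive_exists r lo b s0) as [P [HP0 HP]]; [lra| |].
  { intros s Hs; eapply Cinf_continuity; [apply Hr|exact Hs]. }
  assert (HPs : Cinf (fun s => lo < s < b) P).
  { apply (Cn_bootstrap _ P r HP); intros n _; apply Hr. }
  (* The logarithmic derivative of [U] has to be [sqrt G / ((s - a) h) = 1 / (s - a) + r], and [r]
     is smooth through [a]; the factor [1 / (s0 - a)] normalises [U s0 = 1]. *)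
  set (U := fun s => (s - a) / (s0 - a) * exp (P s)).
  set (U' := fun s => exp (P s) / (s0 - a) * (sqrt (G s) / h s)).
  assert (Hder : forall s, lo < s < b -> is_derive U s (U' s)).
  { intros s Hs; pose proof (HP s Hs) as HPd; unfold U; auto_derive; [eexists; exact HPd|].
    rewrite_derive HPd; unfold U', r; pose proof (Hh s Hs); pose proof (Hsq s Hs).
    assert (E : (s - a) * W s = (sqrt (G s) - h s) * (sqrt (G s) + h s)).
    { transitivity (sqrt (G s) ^ 2 - h s ^ 2); [|ring].
      rewrite pow2_sqrt by (apply Rlt_le; auto); rewrite HGW by exact Hs; unfold h; ring. }
    transitivity (exp (P s) / (s0 - a) * (1 + (s - a) * W s / (h s * (sqrt (G s) + h s)))).
    - field; repeat split; lra.
    - rewrite E; field; repeat split; lra. }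
  exists U, U', (fun s => (s0 - a) * exp (- P s)); split; [exact Hder|].
  split; [|split; [|split; [|split; [|split; [|split]]]]].
  - intros s Hs; apply Rmult_lt_0_compat; apply Rdiv_lt_0_compat; auto; try lra.
    apply exp_pos.
  - intros n; unfold U'; apply Cn_mult; [apply Cn_mult; [|apply Cn_const]|apply Cn_div].
    + apply (Cn_comp n _ (fun _ => True) exp P); [easy|apply Cn_exp|apply HPs].
    + intros s Hs; apply Rgt_not_eq, Hh, Hs.
    + apply Cn_sqrt; [exact HGpos|apply HG].
    + apply Hhs.
  - unfold U; rewrite HP0, exp_0; field; lra.
  - intros n; apply Cn_mult; [apply Cn_const|].
    apply (Cn_comp n _ (fun _ => True) exp (fun s => - P s)); [easy|apply Cn_exp|apply Cn_opp, HPs].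
  - intros s Hs; apply Rmult_lt_0_compat; [lra|apply exp_pos].
  - intros s Hs; unfold U; transitivity ((s - a) * (exp (P s) * exp (- P s))).
    + rewrite <- exp_plus, Rplus_opp_r, exp_0; ring.
    + field; lra.
  - intros s Hs; assert (Hs' : lo < s < b) by lra; pose proof (Hkpos s Hs').
    unfold U, U', h; field; repeat split; lra.
Qed.

(** The bound [m] is the value of [U] at a point left of [a], hence negative: the inverse extends
    past [u = 0], that is, beyond the end point [a] of the orbit. *)
Lemma inverse_up_to_infinity (U U' : R -> R) lo a b :
  (forall s, lo < s < b -> is_derive U s (U' s)) -> (forall s, lo < s < b -> 0 < U' s) ->
  Cinf (fun s => lo < s < b) U' -> lo < a -> a < b -> U a = 0 ->
  (forall u, exists s, lo < s < b /\ u < U s) ->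
  exists m, m < 0 /\ exists V, (forall u, m < u -> lo < V u < b /\ U (V u) = u) /\
    (forall s, lo < s < b -> m < U s -> V (U s) = s) /\
    (forall u, m < u -> is_derive V u (/ U' (V u))) /\ Cinf (fun u => m < u) V.
Proof.
  intros HU Hpos HU' Hlo Hab HUa Hlarge.
  pose proof (increasing_of_derive U U' lo b HU Hpos) as Hincr.
  set (s1 := (lo + a) / 2); assert (Hs1 : lo < s1 < a) by (unfold s1; lra).
  exists (U s1); split; [rewrite <- HUa; apply Hincr; lra|].
  apply (smooth_inverse U U' lo b (U s1) HU Hpos HU').
  intros u Hu; destruct (Hlarge u) as [s2 [Hs2 Hus2]].
  assert (Hle : s1 <= s2).
  { destruct (Rle_lt_dec s1 s2) as [|Hlt]; [assumption|].
    assert (U s2 < U s1) by (apply Hincr; lra); lra. }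
  destruct (last_zero (fun s => U s - u) s1 s2) as [c [Hc [H0 _]]]; [exact Hle| |lra|lra|].
  - intros t Ht; apply continuity_pt_minus; [|apply continuity_pt_const; now intros ? ?].
    eapply is_derive_continuity, HU; lra.
  - exists c; split; lra.
Qed.

(* [q (S t) = e t * p (S t)] with [S = V (e t)]: an end of the orbit, reached when [e t]
   tends to [0], where [S] is a smooth function of [e] up to and beyond [e = 0]. *)
Definition chart (S e q : R -> R) lo hi := exists d V p,
  0 < d /\ Cinf (fun u => - d < u) V /\ (forall u, - d < u -> lo < V u < hi) /\
  Cinf (fun s => lo < s < hi) p /\ (forall s, lo < s < hi -> 0 < p s) /\
  forall t, S t = V (e t) /\ q (S t) = e t * p (S t).

Lemma Cn_reflect n lo hi f : Cn n (fun s => lo < s < hi) f ->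
  Cn n (fun s => - hi < s < - lo) (fun s => f (- s)).
Proof.
  intros Hf; apply (Cn_comp n _ (fun s => lo < s < hi) f Ropp); [intros; lra|exact Hf|].
  apply Cn_opp, Cn_id.
Qed.

(** Along the flow the linearising coordinate [U] at [a] satisfies [U' = 2 U], so the orbit is the
    inverse of [U] taken at [exp (2 * t)]. The coordinate at the other end is obtained by the
    reflection [s -> - s] and describes the same orbit. *)
Lemma flow_exists lo a s0 b hi G k Wa Wb :
  lo < a -> a < s0 -> s0 < b -> b < hi ->
  Cinf (fun s => lo < s < hi) G -> Cinf (fun s => lo < s < hi) k ->
  Cinf (fun s => lo < s < hi) Wa -> Cinf (fun s => lo < s < hi) Wb ->
  (forall s, lo < s < hi -> 0 < G s) -> (forall s, lo < s < hi -> 0 < k s) ->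
  (forall s, lo < s < hi -> G s = ((b - s) * k s) ^ 2 + (s - a) * Wa s) ->
  (forall s, lo < s < hi -> G s = ((s - a) * k s) ^ 2 + (b - s) * Wb s) ->
  exists S, S 0 = s0 /\ (forall t, a < S t < b) /\
    (forall s, a < s < b -> exists! t, S t = s) /\
    (forall t, is_derive S t (2 * ((S t - a) * (b - S t) * k (S t)) / sqrt (G (S t)))) /\
    chart S (fun t => exp (2 * t)) (fun s => s - a) lo b /\
    chart S (fun t => exp (- 2 * t)) (fun s => b - s) a hi.
Proof.
  intros Hlo Ha Hb Hhi HG Hk HWa HWb HGpos Hkpos HGa HGb.
  destruct (linearisation lo a s0 b G k Wa) as
    [U [U' [p [HU [HU'pos [HU' [HU0 [Hp [Hppos [HUp HUg]]]]]]]]]]; auto;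
    try (intros; match goal with H : Cinf _ ?f |- Cinf _ ?f =>
      intros n; apply (Cn_subset n _ (fun s => lo < s < hi)); [intros; lra|apply H] end);
    try (intros; match goal with H : _ |- _ => apply H; lra end).
  destruct (linearisation (- hi) (- b) (- s0) (- a) (fun s => G (- s)) (fun s => k (- s))
    (fun s => Wb (- s))) as
    [Z [Z' [w [HZ [HZ'pos [HZ' [HZ0 [Hw [Hwpos [HZw HZg]]]]]]]]]]; try lra;
    try (intros; match goal with H : Cinf _ ?f |- Cinf _ (fun s => ?f _) =>
      intros n; apply Cn_reflect, (Cn_subset n _ (fun s => lo < s < hi)); [intros; lra|apply H] end);
    try (intros; match goal with H : _ |- _ => apply H; lra end).
  { intros s Hs; rewrite HGb by lra; ring. }
  (* The two coordinates have opposite logarithmic derivatives in [s] and both equal [1] at the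
     starting point, so they are reciprocal. *)
  assert (HUZ : forall s, a < s < b -> U s * Z (- s) = 1).
  { intros s Hs; transitivity (U s0 * Z (- s0)); [|rewrite HU0, HZ0; ring].
    apply (constant_on (fun s => U s * Z (- s)) a b); [|exact Hs|lra].
    clear s Hs; intros s Hs; pose proof (HU s ltac:(lra)) as DU; pose proof (HZ (- s) ltac:(lra)) as DZ.
    auto_derive; [repeat split; eexists; eassumption|].
    rewrite_derive DU; rewrite_derive DZ; rewrite HUg, HZg by lra; rewrite Ropp_involutive.
    assert (0 < k s) by (apply Hkpos; lra); field; repeat split; lra. }
  assert (HUpos : forall s, a < s < b -> 0 < U s).
  { intros s Hs; pose proof (HUp s ltac:(lra)); pose proof (Hppos s ltac:(lra)).
    destruct (Rlt_le_dec 0 (U s)); [assumption|nra]. }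
  assert (HZpos : forall s, - b < s < - a -> 0 < Z s).
  { intros s Hs; pose proof (HZw s ltac:(lra)); pose proof (Hwpos s ltac:(lra)).
    destruct (Rlt_le_dec 0 (Z s)); [assumption|nra]. }
  assert (HUa : U a = 0).
  { pose proof (HUp a ltac:(lra)); pose proof (Hppos a ltac:(lra)); nra. }
  assert (HZb : Z (- b) = 0).
  { pose proof (HZw (- b) ltac:(lra)); pose proof (Hwpos (- b) ltac:(lra)); nra. }
  (* [U] is unbounded towards [b] because its reciprocal tends to [Z (- b) = 0]; this makes the
     orbit exist for all times. *)
  assert (HUlarge : forall u, 1 < u -> exists s, a < s < b /\ u < U s).
  { intros u Hu; assert (Hu' : 0 < / u) by (apply Rinv_0_lt_compat; lra).
    destruct (continuity_pos_near (fun s => / u - Z s) (- b)) as [d [Hd Hnear]].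
    - apply continuity_pt_minus; [apply continuity_pt_const; now intros ? ?|].
      eapply is_derive_continuity, HZ; lra.
    - rewrite HZb; lra.
    - set (s := b - Rmin d (b - a) / 2).
      assert (0 < Rmin d (b - a)) by (apply Rmin_pos; lra).
      pose proof (Rmin_l d (b - a)); pose proof (Rmin_r d (b - a)).
      assert (Hs : a < s < b) by (unfold s; lra).
      exists s; split; [exact Hs|].
      assert (HZs : 0 < / u - Z (- s)) by (apply Hnear, Rabs_def1; unfold s; lra).
      pose proof (HUZ s Hs); pose proof (HUpos s Hs).
      assert (HuZ : u * Z (- s) < 1).
      { apply Rlt_le_trans with (u * / u); [apply Rmult_lt_compat_l; lra|].
        rewrite Rinv_r; lra. }
      pose proof (HZpos (- s) ltac:(lra)).
      apply Rmult_lt_reg_r with (Z (- s)); lra. }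
  assert (HZlarge : forall u, 1 < u -> exists s, - b < s < - a /\ u < Z s).
  { intros u Hu; assert (Hu' : 0 < / u) by (apply Rinv_0_lt_compat; lra).
    destruct (continuity_pos_near (fun s => / u - U s) a) as [d [Hd Hnear]].
    - apply continuity_pt_minus; [apply continuity_pt_const; now intros ? ?|].
      eapply is_derive_continuity, HU; lra.
    - rewrite HUa; lra.
    - set (s := a + Rmin d (b - a) / 2).
      assert (0 < Rmin d (b - a)) by (apply Rmin_pos; lra).
      pose proof (Rmin_l d (b - a)); pose proof (Rmin_r d (b - a)).
      assert (Hs : a < s < b) by (unfold s; lra).
      exists (- s); split; [lra|].
      assert (HUs : 0 < / u - U s) by (apply Hnear, Rabs_def1; unfold s; lra).
      pose proof (HUZ s Hs); pose proof (HUpos s Hs); pose proof (HZpos (- s) ltac:(lra)).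
      assert (HuZ : u * U s < 1).
      { apply Rlt_le_trans with (u * / u); [apply Rmult_lt_compat_l; lra|].
        rewrite Rinv_r; lra. }
      apply Rmult_lt_reg_r with (U s); lra. }
  destruct (inverse_up_to_infinity U U' lo a b HU HU'pos HU') as [m [Hm [V [HV [HVU [HV' HVs]]]]]];
    [lra|lra|exact HUa| |].
  { intros u; destruct (HUlarge (Rmax u 1 + 1)) as [s [Hs Hus]].
    - pose proof (Rmax_r u 1); lra.
    - exists s; split; [lra|]; pose proof (Rmax_l u 1); lra. }
  destruct (inverse_up_to_infinity Z Z' (- hi) (- b) (- a) HZ HZ'pos HZ')
    as [n [Hn [Y [HY [HYZ [HY' HYs]]]]]]; [lra|lra|exact HZb| |].
  { intros u; destruct (HZlarge (Rmax u 1 + 1)) as [s [Hs Hus]].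
    - pose proof (Rmax_r u 1); lra.
    - exists s; split; [lra|]; pose proof (Rmax_l u 1); lra. }
  set (S := fun t => V (exp (2 * t))).
  assert (Hexp : forall t, 0 < exp (2 * t)) by (intros; apply exp_pos).
  assert (HS : forall t, lo < S t < b /\ U (S t) = exp (2 * t)).
  { intros t; apply HV; pose proof (Hexp t); lra. }
  assert (HSab : forall t, a < S t < b).
  { intros t; destruct (HS t) as [Hr He]; split; [|lra].
    pose proof (HUp _ Hr) as Hq; rewrite He in Hq.
    pose proof (Rmult_lt_0_compat _ _ (Hexp t) (Hppos _ Hr)); lra. }
  assert (HZS : forall t, Z (- S t) = exp (- 2 * t)).
  { intros t; pose proof (HUZ _ (HSab t)) as Hq; rewrite (proj2 (HS t)) in Hq.
    apply Rmult_eq_reg_l with (exp (2 * t)); [|pose proof (Hexp t); lra].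
    rewrite Hq, <- exp_plus; replace (2 * t + - 2 * t) with 0 by ring; now rewrite exp_0. }
  exists S; split; [|split; [exact HSab|split; [|split; [|split]]]].
  - unfold S; rewrite Rmult_0_r, exp_0, <- HU0; apply HVU; [lra|rewrite HU0; lra].
  - intros s Hs; pose proof (HUpos s Hs) as HUs; exists (ln (U s) / 2); split.
    + unfold S; replace (2 * (ln (U s) / 2)) with (ln (U s)) by field.
      rewrite exp_ln by exact HUs; apply HVU; lra.
    + intros t Ht; rewrite <- Ht, (proj2 (HS t)), ln_exp; field.
  - intros t; pose proof (Hexp t) as He; destruct (HS t) as [Hr HUS].
    evar_last.
    + apply (is_derive_comp V (fun t => exp (2 * t))); [apply HV'; lra|].
      auto_derive; [easy|reflexivity].
    + fold (S t); rewrite HUg by apply HSab.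
      pose proof (HSab t); pose proof (Hkpos (S t) ltac:(lra)).
      pose proof (sqrt_lt_R0 _ (HGpos (S t) ltac:(lra))).
      unfold scal; simpl; unfold mult; simpl; rewrite HUS; field; repeat split; lra.
  - exists (- m), V, p; split; [lra|]; rewrite Ropp_involutive.
    split; [exact HVs|]; split; [intros u Hu; now apply HV|].
    split; [exact Hp|]; split; [exact Hppos|]; intros t; split; [reflexivity|].
    rewrite <- (proj2 (HS t)); apply HUp, HS.
  - exists (- n), (fun u => - Y u), (fun s => w (- s)); split; [lra|].
    rewrite Ropp_involutive; split; [intros j; apply Cn_opp, HYs|].
    split; [intros u Hu; destruct (HY u Hu); lra|].
    split; [|split].
    + intros j; apply (Cn_subset j _ (fun s => - - a < s < - - hi)); [intros; lra|].
      apply Cn_reflect, Hw.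
    + intros s Hs; apply Hwpos; lra.
    + intros t; pose proof (HSab t); split.
      * rewrite <- HZS, HYZ; [ring|lra|rewrite HZS; pose proof (exp_pos (- 2 * t)); lra].
      * rewrite <- HZS, <- HZw by lra; ring.
Qed.

(** Since [q (S t) = e t * p (S t)] with [e = c^2], the square root of [q * q2] is [c] times the
    smooth positive function [sqrt (p * q2)]. This extracts the factor [exp t] or [exp (- t)] of the
    expansions. *)
Lemma chart_expansion S e c q q2 m lo hi : chart S e q lo hi ->
  (forall t, 0 < c t /\ e t = c t ^ 2) ->
  Cinf (fun s => lo < s < hi) q2 -> (forall s, lo < s < hi -> 0 < q2 s) ->
  Cinf (fun s => lo < s < hi) m ->
  exists xi mu, smooth_halfline xi /\ smooth_halfline mu /\ forall t,
    m (S t) / sqrt (q (S t) * q2 (S t)) = / c t * xi (e t) /\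
    m (S t) * sqrt (q (S t) * q2 (S t)) = c t * mu (e t).
Proof.
  intros [d [V [p [Hd [HV [HVr [Hp [Hppos HS]]]]]]]] Hc Hq2 Hq2pos Hm.
  assert (Hpq : forall s, lo < s < hi -> 0 < p s * q2 s).
  { intros s Hs; apply Rmult_lt_0_compat; auto. }
  assert (Hsmooth : forall f, Cinf (fun s => lo < s < hi) f -> smooth_halfline (fun u => f (V u))).
  { intros f Hf; apply (Cinf_smooth_halfline d); [exact Hd|].
    intros n; apply (Cn_comp n _ (fun s => lo < s < hi)); auto. }
  assert (Hsq : Cinf (fun s => lo < s < hi) (fun s => sqrt (p s * q2 s))).
  { intros n; apply Cn_sqrt; [exact Hpq|]; apply Cn_mult; auto. }
  exists (fun u => m (V u) / sqrt (p (V u) * q2 (V u))), (fun u => m (V u) * sqrt (p (V u) * q2 (V u))).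
  split; [|split].
  - apply (Hsmooth (fun s => m s / sqrt (p s * q2 s))); intros n; apply Cn_div; auto.
    intros s Hs; apply Rgt_not_eq, sqrt_lt_R0; auto.
  - apply (Hsmooth (fun s => m s * sqrt (p s * q2 s))); intros n; apply Cn_mult; auto.
  - intros t; destruct (HS t) as [HSV Hq]; rewrite Hq, <- HSV.
    destruct (Hc t) as [Hct Het].
    assert (Hr : lo < S t < hi).
    { rewrite HSV; apply HVr; rewrite Het; pose proof (pow_lt _ 2 Hct); lra. }
    pose proof (Hpq _ Hr) as Hpos; pose proof (sqrt_lt_R0 _ Hpos).
    replace (sqrt (e t * p (S t) * q2 (S t))) with (c t * sqrt (p (S t) * q2 (S t))).
    + split; field; lra.
    + replace (e t * p (S t) * q2 (S t)) with (c t ^ 2 * (p (S t) * q2 (S t))) by (rewrite Het; ring).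
      rewrite (sqrt_mult (c t ^ 2)); [|apply pow2_ge_0|lra].
      rewrite sqrt_pow2; [reflexivity|lra].
Qed.

(** * Construction of the solutions *)

Definition sphere_expansions (y1 Q : R -> R) := exists xi zeta mu nu : R -> R,
  smooth_halfline xi /\ smooth_halfline zeta /\ smooth_halfline mu /\ smooth_halfline nu /\
  forall t, y1 t = exp (- t) * xi (exp (2 * t)) /\ y1 t = exp t * zeta (exp (- 2 * t)) /\
            Q t = exp t * mu (exp (2 * t)) /\ Q t = exp (- t) * nu (exp (- 2 * t)).

Lemma expansions_of_charts S a b lo hi m1 m2 y1 Q :
  lo < a -> b < hi ->
  chart S (fun t => exp (2 * t)) (fun s => s - a) lo b ->
  chart S (fun t => exp (- 2 * t)) (fun s => b - s) a hi ->
  Cinf (fun s => lo < s < hi) m1 -> Cinf (fun s => lo < s < hi) m2 ->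
  (forall t, y1 t = m1 (S t) / sqrt ((S t - a) * (b - S t))) ->
  (forall t, Q t = m2 (S t) * sqrt ((S t - a) * (b - S t))) ->
  sphere_expansions y1 Q.
Proof.
  intros Hlo Hhi Ca Cb Hm1 Hm2 Hy1 HQ.
  assert (Hl : forall f, Cinf (fun s => lo < s < hi) f -> Cinf (fun s => lo < s < b) f).
  { intros f Hf n; apply (Cn_subset n _ (fun s => lo < s < hi)); [intros; lra|apply Hf]. }
  assert (Hr : forall f, Cinf (fun s => lo < s < hi) f -> Cinf (fun s => a < s < hi) f).
  { intros f Hf n; apply (Cn_subset n _ (fun s => lo < s < hi)); [intros; lra|apply Hf]. }
  assert (Hc : forall t, 0 < exp t /\ exp (2 * t) = exp t ^ 2).
  { intros t; split; [apply exp_pos|].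
    simpl; rewrite Rmult_1_r, <- exp_plus; f_equal; ring. }
  assert (Hc' : forall t, 0 < exp (- t) /\ exp (- 2 * t) = exp (- t) ^ 2).
  { intros t; split; [apply exp_pos|].
    simpl; rewrite Rmult_1_r, <- exp_plus; f_equal; ring. }
  assert (Hqa : Cinf (fun s => lo < s < b) (fun s => b - s)) by (intros n; Cn_auto).
  assert (Hqb : Cinf (fun s => a < s < hi) (fun s => s - a)) by (intros n; Cn_auto).
  destruct (chart_expansion S _ exp _ _ m1 lo b Ca Hc Hqa) as [xi [? [Sxi [_ Exi]]]];
    [intros; lra|auto|].
  destruct (chart_expansion S _ exp _ _ m2 lo b Ca Hc Hqa) as [? [mu [_ [Smu Emu]]]];
    [intros; lra|auto|].
  destruct (chart_expansion S _ (fun t => exp (- t)) _ _ m1 a hi Cb Hc' Hqb)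
    as [zeta [? [Szeta [_ Ezeta]]]]; [intros; lra|auto|].
  destruct (chart_expansion S _ (fun t => exp (- t)) _ _ m2 a hi Cb Hc' Hqb)
    as [? [nu [_ [Snu Enu]]]]; [intros; lra|auto|].
  exists xi, zeta, mu, nu; repeat split; try assumption.
  - rewrite Hy1, exp_Ropp; apply Exi.
  - rewrite Hy1, (Rmult_comm (S t - a)), (proj1 (Ezeta t)), exp_Ropp, Rinv_inv; reflexivity.
  - rewrite HQ; apply Emu.
  - rewrite HQ, (Rmult_comm (S t - a)); apply Enu.
Qed.

(** The formulas of the header with [S = E], [f = sqrt F], [g = sqrt G]. There [Qn = f / 2], which
    gives [y2 - y = 2 f^3 / g^2]. *)
Lemma solution_of_flow (S f g : R -> R) :
  (forall t, 0 < f t) -> (forall t, 0 < g t) ->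
  (forall t, g t ^ 2 = 4 * S t * f t ^ 2 + (1 - S t ^ 2) ^ 2) ->
  (forall t, is_derive S t (2 * f t ^ 2 / g t)) ->
  (forall t, is_derive f t ((1 - S t ^ 2) * f t / g t)) ->
  (forall t, is_derive g t (4 * f t ^ 4 / g t ^ 2)) ->
  exists y2 y3, sol (fun t => (S t ^ 2 - 1) / (2 * f t)) (fun t => g t / (2 * f t)) y2 y3 /\
    forall t, y2 t = (S t ^ 2 - 1) / (2 * f t) + 2 * f t ^ 3 / g t ^ 2.
Proof.
  intros Hf Hg Hrel DS Df Dg.
  exists (fun t => (S t ^ 2 - 1) / (2 * f t) + 2 * f t ^ 3 / g t ^ 2).
  (* With [D = y2 - y] the equation reads [y1 y3 = y1^2 - D (3 y + 2 D)]; it is solved here for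
     [y3]. *)
  exists (fun t => g t / (2 * f t) - (2 * f t ^ 3 / g t ^ 2)
    * (3 * ((S t ^ 2 - 1) / (2 * f t)) + 2 * (2 * f t ^ 3 / g t ^ 2)) / (g t / (2 * f t))).
  split; [|reflexivity].
  assert (Dy : forall t, is_derive (fun t => (S t ^ 2 - 1) / (2 * f t)) t (g t / (2 * f t))).
  { intros t; pose proof (Hf t); pose proof (Hg t); specialize (DS t); specialize (Df t).
    auto_derive; [repeat split; try (eexists; eassumption); lra|].
    rewrite_derive DS; rewrite_derive Df.
    transitivity ((4 * S t * f t ^ 2 + (1 - S t ^ 2) ^ 2) / (2 * f t * g t)); [field; lra|].
    rewrite <- Hrel; field; lra. }
  split; [exact Dy| | |].
  - intros t; pose proof (Hf t); pose proof (Hg t); specialize (Dg t); specialize (Df t).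
    auto_derive; [repeat split; try (eexists; eassumption); lra|].
    rewrite_derive Dg; rewrite_derive Df; field; lra.
  - intros t; pose proof (Hf t); pose proof (Hg t); specialize (Dg t); specialize (Df t).
    evar_last.
    + apply (@is_derive_plus R_AbsRing R_NormedModule); [apply Dy|].
      auto_derive; [|reflexivity].
      repeat split; try (eexists; eassumption); apply Rgt_not_eq; nra.
    + rewrite_derive Dg; rewrite_derive Df; unfold plus; simpl; field; lra.
  - intros t; pose proof (Hf t); pose proof (Hg t); field; lra.
Qed.

Lemma Cn_along_flow n (S h : R -> R) a b : (forall t, a < S t < b) ->
  Cinf (fun s => a < s < b) h -> Cn n (fun _ => True) S -> Cn n (fun _ => True) (fun t => h (S t)).
Proof. intros HS Hh HSn; apply (Cn_comp n _ (fun s => a < s < b)); auto. Qed.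

Lemma Cinf_quartic tau U : Cinf U (quartic tau).
Proof. intros n; unfold quartic, cubic, Rdiv; Cn_auto. Qed.

Lemma is_derive_cubic tau E : is_derive (cubic tau) E (1 - E ^ 2).
Proof. unfold cubic; auto_derive; [easy|field]. Qed.

Lemma is_derive_sqrt_comp (h S : R -> R) t h' l :
  is_derive h (S t) h' -> is_derive S t l -> 0 < h (S t) ->
  is_derive (fun t => sqrt (h (S t))) t (h' * l / (2 * sqrt (h (S t)))).
Proof.
  intros Dh DS Hpos; pose proof (sqrt_lt_R0 _ Hpos).
  evar_last.
  - apply (is_derive_comp sqrt (fun t => h (S t))).
    + auto_derive; [exact Hpos|reflexivity].
    + apply (is_derive_comp h S); eassumption.
  - unfold scal; simpl; unfold mult; simpl; field; lra.
Qed.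

Lemma regular_solution tau : 0 < tau -> 3 * tau ^ 2 < 1 ->
  exists y y1 y2 y3, smooth y /\ ivp tau y y1 y2 y3 /\
    sphere_expansions y1 (Qn y y1 y2).
Proof.
  intros Htau Hsmall.
  destruct (cubic_roots tau Htau Hsmall) as [a [b [Ha [Hb [Hab [Hab' HF]]]]]].
  assert (HFpos : forall E, a < E < b -> 0 < cubic tau E).
  { intros E HE; rewrite HF; repeat apply Rmult_lt_0_compat; lra. }
  assert (HGpos0 : forall E, a <= E <= b -> 0 < quartic tau E).
  { apply quartic_pos; auto; rewrite HF; ring. }
  assert (HGc : forall E, continuity_pt (quartic tau) E).
  { intros E; eapply is_derive_continuity, is_derive_quartic. }
  destruct (continuity_pos_near (quartic tau) a) as [da [Hda Hna]]; [apply HGc|apply HGpos0; lra|].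
  destruct (continuity_pos_near (quartic tau) b) as [db [Hdb Hnb]]; [apply HGc|apply HGpos0; lra|].
  (* To the right of [lo] the factor [E + a + b] stays positive, and between [lo] and [hi] so does
     the quartic. *)
  set (lo := Rmax (a - da) (- (a + b))); set (hi := b + db).
  assert (Hlo : lo < a) by (apply Rmax_lub_lt; lra).
  assert (Hhi : b < hi) by (unfold hi; lra).
  pose proof (Rmax_l (a - da) (- (a + b))) as Hlo1; pose proof (Rmax_r (a - da) (- (a + b))) as Hlo2.
  fold lo in Hlo1, Hlo2.
  set (k := fun E => (E + a + b) / 3).
  assert (Hkpos : forall E, lo < E < hi -> 0 < k E) by (intros E HE; unfold k; lra).
  assert (HGpos : forall E, lo < E < hi -> 0 < quartic tau E).
  { intros E HE; destruct (Rlt_le_dec E a); [apply Hna, Rabs_def1; lra|].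
    destruct (Rlt_le_dec b E); [apply Hnb, Rabs_def1; unfold hi in HE; lra|apply HGpos0; lra]. }
  (* [F = (E - a) ha = (b - E) hb], and [dha], [dhb] are the derivatives of the cofactors. Writing
     [F' = ha + (E - a) dha] in [G = 4 E F + F'^2] yields [G = ha^2] plus a multiple of [E - a];
     likewise at [b]. *)
  set (ha := fun E => (b - E) * ((E + a + b) / 3)); set (dha := fun E => (- 2 * E - a) / 3).
  set (hb := fun E => (E - a) * ((E + a + b) / 3)); set (dhb := fun E => (2 * E + b) / 3).
  destruct (flow_exists lo a 1 b hi (quartic tau) k
    (fun E => 4 * E * ha E + 2 * ha E * dha E + (E - a) * dha E ^ 2)
    (fun E => 4 * E * hb E - 2 * hb E * dhb E + (b - E) * dhb E ^ 2))
    as [S [S0 [HS [_ [DS [Ca Cb]]]]]]; auto; try lra.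
  - apply Cinf_quartic.
  - intros n; unfold k, Rdiv; Cn_auto.
  - intros n; unfold ha, dha, Rdiv; Cn_auto.
  - intros n; unfold hb, dhb, Rdiv; Cn_auto.
  - intros E _; unfold quartic; rewrite HF; unfold k.
    replace (1 - E ^ 2) with (ha E + (E - a) * dha E) by (unfold ha, dha; lra).
    unfold ha, dha; ring.
  - intros E _; unfold quartic; rewrite HF; unfold k.
    replace (1 - E ^ 2) with (- hb E + (b - E) * dhb E) by (unfold hb, dhb; lra).
    unfold hb, dhb; ring.
  - clear ha dha hb dhb.
    set (f := fun t => sqrt (cubic tau (S t))); set (g := fun t => sqrt (quartic tau (S t))).
    assert (Hf : forall t, 0 < f t) by (intros; apply sqrt_lt_R0, HFpos, HS).
    assert (HGS : forall t, 0 < quartic tau (S t)) by (intros t; apply HGpos0; pose proof (HS t); lra).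
    assert (Hg : forall t, 0 < g t) by (intros; apply sqrt_lt_R0, HGS).
    assert (Hf2 : forall t, f t ^ 2 = cubic tau (S t)) by (intros; apply pow2_sqrt, Rlt_le, HFpos, HS).
    assert (Hg2 : forall t, g t ^ 2 = quartic tau (S t)) by (intros; apply pow2_sqrt, Rlt_le, HGS).
    assert (DS' : forall t, is_derive S t (2 * f t ^ 2 / g t)).
    { intros t; evar_last; [apply DS|]; rewrite Hf2, HF; unfold k, g; reflexivity. }
    assert (Hsplit : forall t, 0 < sqrt (k (S t)) /\ 0 < sqrt ((S t - a) * (b - S t)) /\
      f t = sqrt (k (S t)) * sqrt ((S t - a) * (b - S t))).
    { intros t; pose proof (HS t) as Hr; assert (Hk : 0 < k (S t)) by (apply Hkpos; lra).
      assert (Hq : 0 < (S t - a) * (b - S t)) by (apply Rmult_lt_0_compat; lra).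
      split; [now apply sqrt_lt_R0|]; split; [now apply sqrt_lt_R0|].
      unfold f; rewrite HF, Rmult_comm; apply sqrt_mult; apply Rlt_le; assumption. }
    destruct (solution_of_flow S f g) as [y2 [y3 [Hsol Hy2]]]; auto.
    + intros t; rewrite Hg2, Hf2; reflexivity.
    + intros t; pose proof (Hf t); pose proof (Hg t); evar_last.
      * apply is_derive_sqrt_comp; [apply is_derive_cubic|apply DS'|apply HFpos, HS].
      * fold (f t); field; lra.
    + intros t; pose proof (Hf t); pose proof (Hg t); evar_last.
      * apply is_derive_sqrt_comp; [apply is_derive_quartic|apply DS'|apply HGS].
      * fold (g t); rewrite <- Hf2; field; lra.
    + assert (HE1 : cubic tau 1 = (2 * tau) ^ 2) by (unfold cubic; field).
      assert (Hf0 : f 0 = 2 * tau).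
      { unfold f; rewrite S0, HE1; apply sqrt_pow2; lra. }
      assert (Hg0 : g 0 = 2 * f 0).
      { unfold g; rewrite Hf0, S0; apply sqrt_lem_1; [rewrite <- S0; apply Rlt_le, HGS|lra|].
        unfold quartic; rewrite HE1; ring. }
      exists (fun t => (S t ^ 2 - 1) / (2 * f t)), (fun t => g t / (2 * f t)), y2, y3.
      split; [|split].
      * assert (HGinf : Cinf (fun s => a < s < b) (fun s => sqrt (quartic tau s))).
        { intros n; apply Cn_sqrt; [intros; apply HGpos0; lra|apply Cinf_quartic]. }
        assert (HFinf : Cinf (fun s => a < s < b) (cubic tau)) by (intros n; unfold cubic, Rdiv; Cn_auto).
        apply Cinf_smooth; intros n.
        apply (Cn_along_flow n S (fun s => (s ^ 2 - 1) / (2 * sqrt (cubic tau s))) a b HS).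
        -- intros j; apply Cn_div; [|Cn_auto|apply Cn_mult; [Cn_auto|apply Cn_sqrt; auto]].
           intros s Hs; pose proof (sqrt_lt_R0 _ (HFpos s Hs)); lra.
        -- revert n; apply (Cn_bootstrap _ S (fun t => 2 * cubic tau (S t) / sqrt (quartic tau (S t)))).
           { intros t _; rewrite <- Hf2; apply DS'. }
           intros n; apply (Cn_along_flow n S (fun s => 2 * cubic tau s / sqrt (quartic tau s)) a b HS).
           intros j; apply Cn_div; [|apply Cn_mult; [Cn_auto|auto]|auto].
           intros s Hs; apply Rgt_not_eq, sqrt_lt_R0, HGpos0; lra.
      * split; [exact Hsol|]; split; [|split].
        -- rewrite S0; field; pose proof (Hf 0); lra.
        -- rewrite Hg0; field; pose proof (Hf 0); lra.
        -- rewrite Hy2, Hg0, S0, Hf0; field; lra.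
      (* [f] is [sqrt k] times [sqrt ((S - a) (b - S))], while [y1 = g / (2 f)] and [Qn = f / 2]. *)
      * apply (expansions_of_charts S a b lo hi (fun s => sqrt (quartic tau s) / (2 * sqrt (k s)))
          (fun s => sqrt (k s) / 2)); auto.
        -- intros n; apply Cn_div; [|apply Cn_sqrt; [exact HGpos|apply Cinf_quartic]|].
           ++ intros s Hs; pose proof (sqrt_lt_R0 _ (Hkpos s Hs)); lra.
           ++ apply Cn_mult; [Cn_auto|apply Cn_sqrt; [exact Hkpos|unfold k, Rdiv; Cn_auto]].
        -- intros n; unfold Rdiv; apply Cn_mult; [apply Cn_sqrt; [exact Hkpos|]|Cn_auto].
           unfold k, Rdiv; Cn_auto.
        -- intros t; destruct (Hsplit t) as [Hk [Hq Hfk]]; rewrite Hfk; fold (g t); field; lra.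
        -- intros t; destruct (Hsplit t) as [Hk [Hq Hfk]]; pose proof (Hf t); pose proof (Hg t).
           unfold Qn; rewrite Hy2; transitivity (f t / 2); [field; lra|rewrite Hfk; field].
Qed.

Lemma critical_solution tau : 0 < tau -> 3 * tau ^ 2 = 1 ->
  exists y y1 y2 y3, smooth y /\ ivp tau y y1 y2 y3 /\
    sphere_expansions y1 (Qn y y1 y2) /\ exists! t0, y1 t0 = 0.
Proof.
  intros Htau Hcrit; set (r := sqrt 3).
  assert (Hr2 : r ^ 2 = 3) by (apply pow2_sqrt; lra).
  assert (Hr : 0 < r) by (apply sqrt_lt_R0; lra).
  assert (H2 : sqrt 2 ^ 2 = 2) by (apply pow2_sqrt; lra).
  assert (H2pos : 0 < sqrt 2) by (apply sqrt_lt_R0; lra).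
  assert (H2r : sqrt 2 < r) by (apply sqrt_lt_1; lra).
  assert (Hr2' : r < 2) by nra.
  (* This is [crit_field], written as [2 (s + r) (r - s) / sqrt (12 (4 - s^2))]. The start is
     [sqrt 2] because [E = 1] and [y1 > 0] at time [0]; both [W] solve
     [12 (4 - s^2) = 16 r^2 - 12 s^2] for the required decompositions. *)
  destruct (flow_exists (- 2) (- r) (sqrt 2) r 2 (fun s => 12 * (4 - s ^ 2)) (fun _ => 1)
    (fun s => 15 * r - 13 * s) (fun s => 15 * r + 13 * s))
    as [S [S0 [HS [Hbij [DS [Ca Cb]]]]]]; try lra.
  1-4: intros n; Cn_auto.
  - intros s Hs; nra.
  - intros; lra.
  - intros s _; transitivity (16 * r ^ 2 - 12 * s ^ 2); [rewrite Hr2|]; ring.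
  - intros s _; transitivity (16 * r ^ 2 - 12 * s ^ 2); [rewrite Hr2|]; ring.
  - set (w := fun t => sqrt (3 - S t ^ 2)); set (v := fun t => sqrt (4 - S t ^ 2)).
    assert (HS2 : forall t, S t ^ 2 < 3) by (intros t; pose proof (HS t); nra).
    assert (Hw : forall t, 0 < w t) by (intros t; apply sqrt_lt_R0; pose proof (HS2 t); lra).
    assert (Hv : forall t, 0 < v t) by (intros t; apply sqrt_lt_R0; pose proof (HS2 t); lra).
    assert (Hw2 : forall t, w t ^ 2 = 3 - S t ^ 2) by (intros t; apply pow2_sqrt; pose proof (HS2 t); lra).
    assert (Hv2 : forall t, v t ^ 2 = 1 + w t ^ 2).
    { intros t; rewrite Hw2; unfold v; rewrite pow2_sqrt; pose proof (HS2 t); lra. }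
    assert (HSw : forall t, S t ^ 2 = 3 - w t ^ 2) by (intros t; rewrite Hw2; ring).
    assert (DS' : forall t, is_derive S t (w t ^ 2 / (r * v t))).
    { intros t; pose proof (Hv t); evar_last; [apply DS|].
      replace (sqrt (12 * (4 - S t ^ 2))) with (2 * r * v t).
      - transitivity ((r ^ 2 - S t ^ 2) / (r * v t)); [field; lra|].
        rewrite Hr2, Hw2; reflexivity.
      - symmetry; apply sqrt_lem_1; [pose proof (HS2 t); lra|repeat apply Rmult_le_pos; lra|].
        transitivity (4 * r ^ 2 * v t ^ 2); [ring|rewrite Hr2, Hv2, Hw2; ring]. }
    assert (Dw : forall t, is_derive w t (- S t * w t / (r * v t))).
    { intros t; pose proof (Hw t); pose proof (Hv t); evar_last.
      - apply (is_derive_sqrt_comp (fun s => 3 - s ^ 2)); [|apply DS'|pose proof (HS2 t); lra].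
        auto_derive; [easy|reflexivity].
      - fold (w t); field; lra. }
    assert (Dv : forall t, is_derive v t (- S t * w t ^ 2 / (r * v t ^ 2))).
    { intros t; pose proof (Hw t); pose proof (Hv t); evar_last.
      - apply (is_derive_sqrt_comp (fun s => 4 - s ^ 2)); [|apply DS'|pose proof (HS2 t); lra].
        auto_derive; [easy|reflexivity].
      - fold (v t); field; lra. }
    (* The closed forms derived in [ivp_critical_flow]; [D] is [y2 - y] and [D1] its derivative. *)
    set (y := fun t => r * (1 - w t ^ 2) / (2 * w t)).
    set (y1 := fun t => S t * v t / (2 * w t)).
    set (D := fun t => 2 * w t ^ 3 / (r * v t ^ 2)).
    set (D1 := fun t => - 2 * S t * w t ^ 3 / v t ^ 3 + 4 / 3 * S t * w t ^ 5 / v t ^ 5).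
    assert (Dy : forall t, is_derive y t (y1 t)).
    { intros t; pose proof (Hw t); pose proof (Hv t); specialize (Dw t); unfold y.
      auto_derive; [repeat split; try (eexists; eassumption); lra|].
      rewrite_derive Dw; unfold y1.
      transitivity ((1 + w t ^ 2) * S t / (2 * w t * v t)); [field; lra|].
      rewrite <- Hv2; field; lra. }
    assert (Dy1 : forall t, is_derive y1 t (y t + D t)).
    { intros t; pose proof (Hw t); pose proof (Hv t).
      specialize (Dw t); specialize (Dv t); specialize (DS' t); unfold y1.
      auto_derive; [repeat split; try (eexists; eassumption); lra|].
      rewrite_derive Dw; rewrite_derive Dv; rewrite_derive DS'; unfold y, D.
      transitivity ((w t ^ 2 * v t ^ 2 - S t ^ 2 * w t ^ 2 + S t ^ 2 * v t ^ 2)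
                     / (2 * r * w t * v t ^ 2)); [field; lra|].
      transitivity ((r ^ 2 * (1 - w t ^ 2) * v t ^ 2 + 4 * w t ^ 4) / (2 * r * w t * v t ^ 2));
        [|field; lra].
      rewrite Hr2, HSw; f_equal; rewrite Hv2; ring. }
    assert (DD : forall t, is_derive D t (D1 t)).
    { intros t; pose proof (Hw t); pose proof (Hv t); specialize (Dw t); specialize (Dv t); unfold D.
      auto_derive; [repeat split; try (eexists; eassumption); apply Rgt_not_eq; nra|].
      rewrite_derive Dw; rewrite_derive Dv; unfold D1.
      transitivity ((- 6 * S t * w t ^ 3 / v t ^ 3 + 4 * S t * w t ^ 5 / v t ^ 5) / r ^ 2);
        [field; lra|rewrite Hr2; field; lra]. }
    assert (Hw0 : w 0 = 1).
    { unfold w; rewrite S0, H2; replace (3 - 2) with 1 by ring; apply sqrt_1. }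
    assert (Hv0 : v 0 = sqrt 2).
    { unfold v; rewrite S0, H2; f_equal; ring. }
    exists y, y1, (fun t => y t + D t), (fun t => y1 t + D1 t); split; [|split; [|split]].
    + assert (Hinf : Cinf (fun s => - r < s < r) (fun s => sqrt (3 - s ^ 2))).
      { intros n; apply Cn_sqrt; [intros; nra|Cn_auto]. }
      apply Cinf_smooth; intros n.
      apply (Cn_along_flow n S (fun s => r * (1 - sqrt (3 - s ^ 2) ^ 2) / (2 * sqrt (3 - s ^ 2)))
               (- r) r HS).
      * intros j; pose proof (Hinf j); apply Cn_div; [|Cn_auto|Cn_auto].
        intros s Hs; assert (0 < sqrt (3 - s ^ 2)) by (apply sqrt_lt_R0; nra); lra.
      * revert n; apply (Cn_bootstrap _ S (fun t => w t ^ 2 / (r * v t))); [intros; apply DS'|].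
        intros n; apply (Cn_along_flow n S
          (fun s => sqrt (3 - s ^ 2) ^ 2 / (r * sqrt (4 - s ^ 2))) (- r) r HS).
        intros j; pose proof (Hinf j); apply Cn_div; [|Cn_auto|apply Cn_mult; [Cn_auto|]].
        -- intros s Hs; assert (0 < sqrt (4 - s ^ 2)) by (apply sqrt_lt_R0; nra); nra.
        -- apply Cn_sqrt; [intros; nra|Cn_auto].
    + split; [split; auto|split; [|split]].
      * intros t; apply (@is_derive_plus R_AbsRing R_NormedModule y D); auto.
      * intros t; pose proof (Hw t); pose proof (Hv t).
        assert (HD1 : y1 t * D1 t = - D t * (3 * y t + 2 * D t)); [|lra].
        unfold y1, D1, D, y.
        transitivity (S t ^ 2 * (- 3 * v t ^ 2 * w t ^ 2 + 2 * w t ^ 4) / (3 * v t ^ 4)); [field; lra|].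
        transitivity ((- 3 * r ^ 2 * w t ^ 2 * (1 - w t ^ 2) * v t ^ 2 - 8 * w t ^ 6)
                       / (r ^ 2 * v t ^ 4)); [|field; lra].
        rewrite Hr2, HSw; f_equal; rewrite Hv2; ring.
      * unfold y; rewrite Hw0; field.
      * unfold y1; rewrite Hw0, Hv0, S0; transitivity (sqrt 2 ^ 2 / 2); [field|rewrite H2; field].
      * unfold y, D; rewrite Hw0, Hv0, H2.
        transitivity (1 / r); [field; lra|].
        apply Rmult_eq_reg_r with (3 * tau); [|lra].
        assert (Hrt : r * tau = 1).
        { rewrite <- (sqrt_pow2 tau) by lra; unfold r; rewrite <- sqrt_mult by nra.
          rewrite Hcrit; apply sqrt_1. }
        transitivity (3 * tau / r); [field; lra|].
        rewrite <- Hr2; transitivity (r * tau); [field; lra|].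
        rewrite Hrt, Hr2; lra.
    + assert (Hprod : forall t, sqrt ((S t - - r) * (r - S t)) = w t).
      { intros t; unfold w; f_equal; rewrite <- Hr2; ring. }
      apply (expansions_of_charts S (- r) r (- 2) 2 (fun s => s * sqrt (4 - s ^ 2) / 2)
          (fun s => s ^ 2 / (2 * r))); try assumption; try lra.
      * intros n; unfold Rdiv; apply Cn_mult; [apply Cn_mult; [Cn_auto|]|Cn_auto].
        apply Cn_sqrt; [intros; nra|Cn_auto].
      * intros n; unfold Rdiv; Cn_auto.
      * intros t; rewrite Hprod; fold (v t); unfold y1; field; pose proof (Hw t); lra.
      * intros t; rewrite Hprod; pose proof (Hw t); pose proof (Hv t).
        unfold Qn, y1; replace (y t + D t - y t) with (D t) by ring; unfold D; field; lra.
    (* [y1] vanishes exactly where [S = 0], a value that the orbit takes once. *)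
    + destruct (Hbij 0) as [t0 [Ht0 Huniq]]; [lra|].
      exists t0; split.
      * unfold y1; rewrite Ht0; field; pose proof (Hw t0); lra.
      * intros t Ht; apply Huniq; pose proof (Hw t); pose proof (Hv t).
        unfold y1 in Ht; apply Rmult_eq_reg_r with (v t / (2 * w t)).
        -- rewrite Rmult_0_l, <- Ht; field; lra.
        -- apply Rgt_not_eq, Rdiv_lt_0_compat; lra.
Qed.

Lemma sinh_solution : smooth sinh /\ ivp 0 sinh cosh sinh cosh /\
  sphere_expansions cosh (Qn sinh cosh sinh).
Proof.
  assert (Hs : forall t, is_derive sinh t (cosh t)).
  { intros t; apply is_derive_Reals, derivable_pt_lim_sinh. }
  assert (Hc : forall t, is_derive cosh t (sinh t)).
  { intros t; apply is_derive_Reals, derivable_pt_lim_cosh. }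
  split; [|split; [split; [split; auto|]|]].
  - assert (Hboth : forall n, Cn n (fun _ => True) sinh /\ Cn n (fun _ => True) cosh).
    { intros n; induction n as [|n [IHs IHc]]; [easy|].
      split; [exists cosh|exists sinh]; auto. }
    apply Cinf_smooth; intros n; apply Hboth.
  - intros t; ring.
  - repeat split; [apply sinh_0|apply cosh_0|apply sinh_0].
  - assert (H1 : smooth_halfline (fun u => (1 + u) / 2)).
    { apply (Cinf_smooth_halfline 1); [lra|]; intros n; unfold Rdiv; Cn_auto. }
    assert (H0 : smooth_halfline (fun _ => 0)).
    { apply (Cinf_smooth_halfline 1); [lra|]; intros n; Cn_auto. }
    exists (fun u => (1 + u) / 2), (fun u => (1 + u) / 2), (fun _ => 0), (fun _ => 0).
    repeat split; auto; unfold cosh, Qn.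
    + replace (2 * t) with (t + t) by ring; rewrite exp_plus.
      transitivity (exp t * (exp t * exp (- t)) / 2 + exp (- t) / 2); [|field].
      rewrite <- exp_plus, Rplus_opp_r, exp_0; field.
    + replace (- 2 * t) with (- t + - t) by ring; rewrite exp_plus.
      transitivity (exp t / 2 + exp (- t) * (exp t * exp (- t)) / 2); [|field].
      rewrite <- exp_plus, Rplus_opp_r, exp_0; field.
    + ring.
    + ring.
Qed.

(** * Classification *)

Lemma ivp_unique tau y y1 y2 y3 z z1 z2 z3 : 0 <= tau -> 3 * tau ^ 2 <= 1 ->
  ivp tau y y1 y2 y3 -> ivp tau z z1 z2 z3 -> forall t, y t = z t.
Proof.
  intros Htau Hle Hy Hz t.
  destruct (Req_dec tau 0) as [->|H0].
  { rewrite (ivp_zero_sinh _ _ _ _ Hy), (ivp_zero_sinh _ _ _ _ Hz); reflexivity. }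
  destruct (Req_dec (3 * tau ^ 2) 1).
  - eapply ivp_critical_unique; eauto; lra.
  - eapply ivp_regular_unique; eauto; lra.
Qed.

(** [Rn' = 0] gives [(y2 - y) y1 = 0]. If [y2 <> y] at some time, then [y1 = 0] nearby, so
    [y1 = y2 = 0] there, and the equation leaves [y^2 = 0], a contradiction. *)
Lemma Rn_zero_linear y y1 y2 y3 : sol y y1 y2 y3 -> (forall t, Rn y y1 y2 t = 0) ->
  forall t, y2 t = y t.
Proof.
  intros H HR.
  assert (HDp : forall t, (y2 t - y t) * y1 t = 0).
  { intros t; pose proof (is_derive_Rn _ _ _ _ t H) as DR; apply is_derive_unique in DR.
    rewrite (Derive_ext _ (fun _ => 0)), Derive_const in DR by exact HR.
    apply Rsqr_0_uniq; rewrite Rsqr_pow2; now symmetry. }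
  intros t; apply NNPP; intros Hne.
  destruct (continuity_pos_near (fun u => (y2 u - y u) ^ 2) t) as [d [Hd Hnear]].
  - apply (continuity_pt_comp (fun u => y2 u - y u) (fun x => x ^ 2)).
    + apply continuity_pt_minus; apply (sol_continuity _ _ _ _ t H).
    + apply derivable_continuous_pt, derivable_pt_pow.
  - apply pow2_gt_0; lra.
  - assert (Hp : forall u, Rabs (u - t) < d -> y1 u = 0).
    { intros u Hu; specialize (Hnear u Hu); specialize (HDp u).
      apply Rmult_integral in HDp; destruct HDp as [H0|]; [rewrite H0 in Hnear; lra|assumption]. }
    assert (Hy1 : y1 t = 0) by (apply Hp; rewrite Rminus_diag, Rabs_R0; exact Hd).
    assert (Hy2 : y2 t = 0).
    { rewrite <- (is_derive_unique _ _ _ (sol_d2 _ _ _ _ H t)).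
      rewrite (Derive_ext_loc _ (fun _ => 0)); [apply Derive_const|].
      exists (mkposreal d Hd); intros u Hu; apply Hp, Hu. }
    pose proof (sol_eq _ _ _ _ H t) as Heq; rewrite Hy1, Hy2 in Heq.
    apply Hne; rewrite Hy2; nra.
Qed.

(** The shift [a = ln (A / B) / 2] balances the two exponentials, since [A = B exp (2 a)]. The
    [sinh] form serves coefficients of opposite signs. *)
Lemma exp_combination A B : 0 < A * B ->
  exists c a, forall t, A * exp t + B * exp (- t) = c * cosh (t + a) /\
                        A * exp t - B * exp (- t) = c * sinh (t + a).
Proof.
  intros HAB.
  assert (HA : A <> 0) by (intros ->; lra); assert (HB : B <> 0) by (intros ->; lra).
  assert (Hpos : 0 < A / B).
  { replace (A / B) with (A * B / B ^ 2) by (field; exact HB).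
    apply Rdiv_lt_0_compat; [exact HAB|now apply pow2_gt_0]. }
  set (a := ln (A / B) / 2).
  assert (He : exp a * exp a = A / B).
  { rewrite <- exp_plus; unfold a; replace (ln (A / B) / 2 + ln (A / B) / 2) with (ln (A / B)) by field.
    now apply exp_ln. }
  pose proof (exp_pos a) as Hea.
  assert (HAa : A = B * (exp a * exp a)) by (rewrite He; field; exact HB).
  exists (2 * B * exp a), a; intros t; unfold cosh, sinh.
  rewrite Ropp_plus_distr, !exp_plus, (exp_Ropp a), HAa.
  split; field; lra.
Qed.

Lemma linear_obtained (y : R -> R) A B :
  (forall t, y t = A * exp t + B * exp (- t)) ->
  obtained_from exp y \/ obtained_from cosh y \/ obtained_from sinh y.
Proof.
  intros Hy; destruct (Rtotal_order (A * B) 0) as [Hneg|[H0|Hpos]].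
  - destruct (exp_combination A (- B)) as [c [a Hca]]; [lra|].
    right; right; exists c, a, 1; split; [now left|]; intros t.
    rewrite Rmult_1_l, Hy, <- (proj2 (Hca t)); ring.
  - left; apply Rmult_integral in H0; destruct H0 as [->| ->].
    + exists B, 0, (-1); split; [now right|]; intros t.
      replace (-1 * t + 0) with (- t) by ring; rewrite Hy; ring.
    + exists A, 0, 1; split; [now left|]; intros t.
      replace (1 * t + 0) with t by ring; rewrite Hy; ring.
  - destruct (exp_combination A B) as [c [a Hca]]; [lra|].
    right; left; exists c, a, 1; split; [now left|]; intros t.
    rewrite Rmult_1_l, Hy, <- (proj1 (Hca t)); ring.
Qed.

(** Reversal of time changes the sign of [Rn], while [y -> - y] preserves it and changes that of
    [y1]. So [s] is chosen first, then [c]; [exists_zero] supplies the new time origin and [/ p]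
    normalises the velocity. *)
Lemma normalise y y1 y2 y3 t1 : sol y y1 y2 y3 -> Rn y y1 y2 t1 <> 0 ->
  exists tau z z1 z2 z3, 0 < tau /\ ivp tau z z1 z2 z3 /\ obtained_from z y.
Proof.
  intros H HR.
  assert (Hsign : forall a, a <> 0 -> exists s, (s = 1 \/ s = -1) /\ 0 < s * a).
  { intros a Ha; destruct (Rlt_le_dec 0 a); [exists 1|exists (-1)]; split; auto; lra. }
  destruct (Hsign _ HR) as [s [Hs HsR]].
  assert (Hp : s * y1 t1 <> 0).
  { intros H0; apply Rmult_integral in H0; destruct H0 as [H0|H0]; [destruct Hs; lra|].
    apply HR; unfold Rn; rewrite H0; ring. }
  destruct (Hsign _ Hp) as [c [Hc Hcp]].
  assert (Hss : s * s = 1) by (destruct Hs; subst; ring).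
  assert (Hcc : c * c = 1) by (destruct Hc; subst; ring).
  pose proof (sol_affine y y1 y2 y3 c s 0 Hs H) as H'.
  assert (Hpt : s * (s * t1) + 0 = t1).
  { transitivity (s * s * t1); [ring|rewrite Hss; ring]. }
  destruct (exists_zero _ _ _ _ (s * t1) H') as [t2 [Z0 [Z1 Z2]]].
  - unfold Rn; rewrite Hpt.
    replace ((c * y2 t1 - c * y t1) * (c * s * y1 t1) ^ 3)
      with ((c * c) ^ 2 * (s * s) * (s * Rn y y1 y2 t1)) by (unfold Rn; ring).
    rewrite Hcc, Hss; lra.
  - rewrite Hpt; lra.
  - set (p := c * s * y1 (s * t2 + 0)) in *.
    pose proof (sol_affine _ _ _ _ (/ p) 1 t2 (or_introl eq_refl) H') as Hz.
    exists (/ p * (c * y2 (s * t2 + 0))).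
    do 4 eexists; split; [apply Rmult_lt_0_compat; [now apply Rinv_0_lt_compat|exact Z2]|].
    split; [split; [exact Hz|]|].
    + simpl; replace (1 * 0 + t2) with t2 by ring; rewrite Z0; fold p.
      split; [ring|split; [field; lra|reflexivity]].
    + exists (p * c), (- t2), s; split; [exact Hs|]; intros t; simpl.
      replace (s * (1 * (s * t + - t2) + t2) + 0) with (s * s * t) by ring.
      rewrite Hss, Rmult_1_l; transitivity (c * c * y t); [rewrite Hcc; ring|field; lra].
Qed.

(** All properties are bundled so that a single choice of function for each [tau] carries them
    together. *)
Definition sphere_solution tau y := exists y1 y2 y3,
  smooth y /\ ivp tau y y1 y2 y3 /\ sphere_expansions y1 (Qn y y1 y2) /\
  (3 * tau ^ 2 < 1 -> forall t, 0 < y1 t) /\ (3 * tau ^ 2 = 1 -> exists! t0, y1 t0 = 0).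

Lemma sphere_solution_exists tau : 0 <= tau -> 3 * tau ^ 2 <= 1 ->
  exists y, sphere_solution tau y.
Proof.
  intros H0 Hle; destruct (Req_dec tau 0) as [->|Hne].
  - destruct sinh_solution as [Hs [Hi He]]; exists sinh, cosh, sinh, cosh.
    repeat split; try apply Hi; try assumption; [|lra].
    intros _ t; unfold cosh; pose proof (exp_pos t); pose proof (exp_pos (- t)); lra.
  - destruct (Req_dec (3 * tau ^ 2) 1) as [Hcrit|Hreg].
    + destruct (critical_solution tau) as [y [y1 [y2 [y3 [Hs [Hi [He Hz]]]]]]]; [lra|lra|].
      exists y, y1, y2, y3; split; [exact Hs|split; [exact Hi|split; [exact He|split; [lra|]]]].
      intros _; exact Hz.
    + destruct (regular_solution tau) as [y [y1 [y2 [y3 [Hs [Hi He]]]]]]; [lra|lra|].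
      exists y, y1, y2, y3; split; [exact Hs|split; [exact Hi|split; [exact He|split; [|lra]]]].
      intros _ t; eapply ivp_regular; eauto; lra.
Qed.

Theorem theorem2p1 :
  exists T : R, 0 < T /\
  exists x : R -> R -> R,
    (forall tau : R, 0 <= tau <= T ->
       ivp_solution tau (x tau) /\
       forall y : R -> R, ivp_solution tau y -> forall t : R, y t = x tau t) /\
    (forall y : R -> R, global_solution y ->
       obtained_from exp y \/ obtained_from cosh y \/
       exists tau : R, 0 <= tau <= T /\ obtained_from (x tau) y) /\
    (forall tau : R, 0 <= tau <= T ->
       exists xi zeta mu nu : R -> R,
         smooth_halfline xi /\ smooth_halfline zeta /\
         smooth_halfline mu /\ smooth_halfline nu /\
         forall t : R,
           Derive (x tau) t = exp (- t) * xi (exp (2 * t)) /\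
           Derive (x tau) t = exp t * zeta (exp (- 2 * t)) /\
           (Derive_n (x tau) 2 t - x tau t) * (Derive (x tau) t) ^ 2
             = exp t * mu (exp (2 * t)) /\
           (Derive_n (x tau) 2 t - x tau t) * (Derive (x tau) t) ^ 2
             = exp (- t) * nu (exp (- 2 * t))) /\
    (forall tau : R, 0 <= tau <= T ->
       ((forall t : R, 0 < Derive (x tau) t) <-> tau < T)) /\
    (exists! t0 : R, Derive (x T) t0 = 0).
Proof.
  set (T := / sqrt 3).
  assert (H3 : 0 < sqrt 3) by (apply sqrt_lt_R0; lra).
  assert (HT : 0 < T) by now apply Rinv_0_lt_compat.
  assert (HT2 : 3 * T ^ 2 = 1).
  { unfold T; rewrite pow_inv, pow2_sqrt by lra; field. }
  exists T; split; [exact HT|].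
  (* A function is selected for every real [tau]; only for [0 <= tau <= T] is it known to have the
     bundled properties. *)
  exists (fun tau => epsilon (inhabits (fun _ => 0)) (sphere_solution tau)).
  assert (Hx : forall tau, 0 <= tau <= T ->
    sphere_solution tau (epsilon (inhabits (fun _ => 0)) (sphere_solution tau))).
  { intros tau Htau; apply epsilon_spec, sphere_solution_exists; nra. }
  set (x := fun tau => epsilon (inhabits (fun _ => 0)) (sphere_solution tau)) in *.
  assert (Hivp : forall tau y, ivp_solution tau y -> ivp tau y (Derive y) (Derive_n y 2) (Derive_n y 3)).
  { intros tau y [Hg Hi]; split; [now apply global_solution_sol|exact Hi]. }
  assert (Huniq : forall tau y y1 y2 y3, 0 <= tau <= T -> ivp tau y y1 y2 y3 -> forall t, y t = x tau t).
  { intros tau y y1 y2 y3 Htau Hy; destruct (Hx tau Htau) as [x1 [x2 [x3 [_ [Hi _]]]]].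
    eapply ivp_unique; eauto; nra. }
  change (fun tau : R => epsilon (inhabits (fun _ : R => 0)) (sphere_solution tau)) with x.
  split; [|split; [|split; [|split]]].
  - intros tau Htau; split; [|intros y Hy; eapply Huniq; eauto].
    destruct (Hx tau Htau) as [x1 [x2 [x3 [Hs [[Hsol [H0 [H1 H2]]] _]]]]].
    destruct (sol_derivatives _ _ _ _ Hsol 0) as [E1 [E2 _]].
    split; [eapply sol_global_solution; eauto|].
    split; [exact H0|split; [now rewrite E1|now rewrite E2]].
  - intros y Hy; apply global_solution_sol in Hy.
    (* A nonzero value of [Rn] leads to the initial value problem with [0 < tau <= T]; otherwise the
       solution is linear and comes from [exp], [cosh] or [sinh], the last being [x 0]. *)
    destruct (classic (exists t, Rn y (Derive y) (Derive_n y 2) t <> 0)) as [[t1 Ht1]|Hno].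
    + destruct (normalise _ _ _ _ t1 Hy Ht1) as [tau [z [z1 [z2 [z3 [Htau [Hz [a1 [a0 [s [Hs Ho]]]]]]]]]]].
      assert (Hle : 0 <= tau <= T).
      { split; [lra|]; destruct (Rle_lt_dec tau T); [assumption|exfalso].
        eapply ivp_supercritical; [exact Htau| |exact Hz]; nra. }
      right; right; exists tau; split; [exact Hle|].
      exists a1, a0, s; split; [exact Hs|]; intros t; rewrite Ho.
      f_equal; eapply Huniq; eauto.
    + assert (Hlin : forall t, Derive_n y 2 t = y t).
      { apply (Rn_zero_linear _ _ _ _ Hy); intros t; apply NNPP; eauto. }
      destruct (linear_obtained y ((y 0 + Derive y 0) / 2) ((y 0 - Derive y 0) / 2)) as [H|[H|H]].
      * apply (second_order_linear y (Derive y)); [apply Hy|].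
        intros t; rewrite <- Hlin; apply Hy.
      * now left.
      * now right; left.
      * right; right; exists 0; split; [lra|].
        destruct H as [a1 [a0 [s [Hs Ho]]]]; exists a1, a0, s; split; [exact Hs|].
        intros t; rewrite Ho; f_equal.
        destruct sinh_solution as [_ [Hi _]]; eapply Huniq; [lra|exact Hi].
  - intros tau Htau; destruct (Hx tau Htau) as [x1 [x2 [x3 [_ [[Hsol _] [He _]]]]]].
    destruct He as [xi [zeta [mu [nu [S1 [S2 [S3 [S4 He]]]]]]]].
    exists xi, zeta, mu, nu; do 4 (split; [assumption|]); intros t.
    destruct (sol_derivatives _ _ _ _ Hsol t) as [E1 [E2 _]]; rewrite E1, E2; apply He.
  - intros tau Htau; destruct (Hx tau Htau) as [x1 [x2 [x3 [_ [[Hsol _] [_ [Hpos Hz]]]]]]].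
    assert (E1 : forall t, Derive (x tau) t = x1 t) by (intros t; apply (sol_derivatives _ _ _ _ Hsol)).
    split.
    + intros Hall; destruct (Rlt_le_dec tau T) as [|Hge]; [assumption|exfalso].
      assert (Heq : tau = T) by lra; destruct Hz as [t0 [Ht0 _]]; [now rewrite Heq|].
      specialize (Hall t0); rewrite E1, Ht0 in Hall; lra.
    + intros Hlt t; rewrite E1; apply Hpos; nra.
  - destruct (Hx T) as [x1 [x2 [x3 [_ [[Hsol _] [_ [_ Hz]]]]]]]; [lra|].
    assert (E1 : forall t, Derive (x T) t = x1 t) by (intros t; apply (sol_derivatives _ _ _ _ Hsol)).
    destruct (Hz HT2) as [t0 [Ht0 Hu]]; exists t0; split; [now rewrite E1|].
    intros t Ht; apply Hu; now rewrite <- E1.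
Qed.
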